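(* Let $T$ be a tree with $k$ edges. Suppose $T$ has exactly $p$ preleaves and one of them is adjacent to at least $(k-p-1)/2$ leaves of $T$. Then every finite simple undirected graph $G$ with $2e(G) > (k-1)v(G)$ (i.e., average degree strictly greater than $k-1$) contains $T$ as a subgraph.
   Context: For a graph $G$, $v(G)$ and $e(G)$ denote the numbers of vertices and edges. A leaf of a tree is a vertex of degree 1; a preleaf is a vertex adjacent to a leaf. *)

(* Defs.v *)
From mathcomp Require Import all_boot.

Set Implicit Arguments.
Unset Strict Implicit.
Unset Printing Implicit Defensive.

(* Finite simple undirected graphs; the vertex set may be empty. *)
Record sgraph := SGraph {
  vertex :> finType;
  adj : rel vertex;
  adj_sym : symmetric adj;
  adj_irrefl : irreflexive adj }.

Arguments adj {G} x y : rename.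

Definition nvertices (G : sgraph) : nat := #|vertex G|.

(* Edges are unordered pairs, so each one is counted once. *)
Definition edges (G : sgraph) : {set {set G}} :=
  [set [set xy.1; xy.2] | xy : G * G & adj xy.1 xy.2].

Definition nedges (G : sgraph) : nat := #|edges G|.

Definition degree (G : sgraph) (x : G) : nat := #|[set y | adj x y]|.

Definition connected (G : sgraph) : Prop :=
  0 < nvertices G /\ forall x y : G, connect adj x y.

(* The bound on the size discards the closed walks [:: x; y] along an edge,
   which [ucycle] accepts because the relation is symmetric. *)
Definition acyclic (G : sgraph) : Prop :=
  forall c : seq G, 2 < size c -> ~ ucycle adj c.

Definition is_tree (G : sgraph) : Prop := connected G /\ acyclic G.

Definition leaves (G : sgraph) : {set G} := [set x | degree x == 1].

(* A preleaf may itself be a leaf: this happens for the tree with one edge. *)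
Definition preleaves (G : sgraph) : {set G} :=
  [set x | [exists y in leaves G, adj x y]].

(* H is isomorphic to a (not necessarily induced) subgraph of G. *)
Definition contains (G H : sgraph) : Prop :=
  exists f : H -> G, injective f /\ forall x y, adj x y -> adj (f x) (f y).

(* Main.v *)
Require Import Defs.
From mathcomp Require Import all_boot all_order all_algebra perm zify.

Set Implicit Arguments.
Unset Strict Implicit.
Unset Printing Implicit Defensive.

(* In a vertex-minimal subgraph of average degree above k - 1, every nonempty vertex set S
   meets more than (k - 1)|S|/2 edges.  Root T at a preleaf v with the most leaves, send v to
   a vertex x of degree at least k, embed the other non-leaves greedily and place the leaves
   by Hall's theorem; the leaves at v never obstruct.  If this fails, the images S of some of
   the q = p - 1 other preleaves have all their neighbours in a small set Z that contains the
   image of the non-leaves.  The edge count gives 2|Z| > k + |S|, which forces |S| >= q - 1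
   and bounds by q + 1 the number of vertices whose neighbourhoods stay inside Z.  Moving a
   preleaf u1 that is extremal in the tree to another neighbour of the image of its parent
   must lead to the same kind of failure, and for q >= 3 this gives too many such vertices.
   For q = 1 every vertex of the image but x can be made the image of u1.  For q = 2 and
   k = 2h a finite analysis of exchanges leaves only one obstruction, a complete bipartite
   graph with parts of sizes h and h + 1, and such a graph contains T. *)


(** * Hall's marriage theorem *)

(** The proof plays two bounds against each other. Let [N] be the number of vertices of [T] without
    the leaves at [v]; the hypothesis on the preleaf becomes [2 * N <= k + q + 4]. If [i] bearers
    obstruct the leaves, the core image together with the neighbours of these bearers has fewer than
    [N - (q - i)] vertices, because every other bearer has a leaf of its own, and more than
    [(k + i) / 2] vertices by the edge count. Hence [i >= q - 1]. With one unit less in the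
    hypothesis [i = q], which soon leads to a contradiction for [q >= 2]; the last unit of slack is
    the whole difficulty. It is fought with closed vertices: a vertex of a set [Z] is called closed
    in [Z] if all its neighbours lie in [Z]. As [s] closed vertices force [k + s < 2 * #|Z|], each
    exchange aims at one closed vertex too many. The gain grows with [q] while the slack does not,
    which is why [q <= 2] needs separate arguments. *)

Section Hall.
Variables (I G : finType) (x0 : G).

Lemma hall_marriage (F : I -> {set G}) (D : {set I}) :
  (forall J : {set I}, J \subset D -> #|J| <= #|\bigcup_(i in J) F i|) ->
  exists g : I -> G, {in D &, injective g} /\ {in D, forall i, g i \in F i}.
Proof.
have [n] := ubnP #|D|; elim: n F D => // n IHn F D leDn hallF.
have [->|[i0 Di0]] := set_0Vmem D.
  by exists (fun=> x0); split=> [i j|i]; rewrite inE.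
(* A proper tight set is matched within its own values and the rest outside them. Without such a set
   every proper nonempty set has a value to spare, so [i0] may take any of its values. *)
case: (pickP [pred J : {set I} | [&& J != set0, J \proper D
  & #|\bigcup_(i in J) F i| <= #|J|]]) => [J /and3P[J0 JD tightJ]|loose].
- have JsD := proper_sub JD.
  have ltJ : #|J| < #|D| by apply: proper_card.
  have [|J' sJ'|g [ginj gF]] := IHn F J; first by lia.
    by apply: hallF; apply: subset_trans sJ' JsD.
  pose FJ := \bigcup_(i in J) F i.
  have cDJ : #|D :\: J| = #|D| - #|J| by rewrite cardsD (setIidPr JsD).
  have [|J' sJ'|h [hinj hF]] := IHn (fun i => F i :\: FJ) (D :\: J).
  + by move: J0; rewrite -card_gt0; lia.
  + have dis : [disjoint J & J'].
      rewrite disjoint_sym; apply/pred0P=> i /=; apply/negbTE/negP=> /andP[iJ' iJ].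
      by have /setDP[_] := subsetP sJ' _ iJ'; rewrite iJ.
    have := hallF (J :|: J'); rewrite subUset JsD (subset_trans sJ' (subsetDl _ _)).
    move=> /(_ isT); rewrite cardsU disjoint_setI0 // cards0 subn0 => le1.
    have le2 : #|\bigcup_(i in J :|: J') F i| <= #|FJ| + #|\bigcup_(i in J') (F i :\: FJ)|.
      apply: leq_trans (leq_card_setU _ _); apply: subset_leq_card.
      apply/bigcupsP=> i; rewrite inE => iJJ; apply/subsetP=> y Fy.
      rewrite inE; case: (boolP (y \in FJ)) => //= yFJ.
      case/orP: iJJ => [iJ|iJ'].
        by case/negP: yFJ; apply/bigcupP; exists i.
      by apply/bigcupP; exists i => //; rewrite inE yFJ.
    by rewrite /FJ in le2 *; lia.
  exists (fun i => if i \in J then g i else h i); split.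
  + have gh i j : i \in J -> j \in D -> j \notin J -> g i <> h j.
      move=> iJ jD jJ eq; have := hF j; rewrite !inE jJ jD => /(_ isT) /andP[+ _].
      by rewrite -eq => /negP; apply; apply/bigcupP; exists i => //; apply: gF.
    move=> i j iD jD; case: ifPn => iJ; case: ifPn => jJ eq.
    * exact: ginj.
    * by case: (gh i j).
    * by case: (gh j i).
    * by apply: hinj; rewrite ?inE ?iJ ?jJ.
  + move=> i iD; case: ifPn => iJ; first exact: gF.
    by have := hF i; rewrite !inE iJ iD => /(_ isT) /andP[].
- have [y Fy] : exists y, y \in F i0.
    have := hallF [set i0]; rewrite sub1set Di0 cards1 big_set1 => /(_ isT).
    by case/card_gt0P=> y; exists y.
  have cD : #|D| = (#|D :\ i0|).+1 by rewrite (cardsD1 i0 D) Di0.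
  have [|J sJ|g [ginj gF]] := IHn (fun i => F i :\ y) (D :\ i0).
  + by lia.
  + have [->|J0] := eqVneq J set0; first by rewrite cards0.
    have JD : J \proper D.
      apply: sub_proper_trans sJ _; rewrite properEcard subsetDl cD; lia.
    have := loose J; rewrite /= J0 JD /= => /negbT; rewrite -ltnNge => lt.
    have le2 : #|\bigcup_(i in J) F i| <= #|\bigcup_(i in J) (F i :\ y)| + 1.
      rewrite addnC -(cards1 y); apply: leq_trans (leq_card_setU _ _).
      apply: subset_leq_card; apply/bigcupsP=> i iJ; apply/subsetP=> z Fz.
      rewrite !inE; case: eqVneq => //= zy.
      by apply/bigcupP; exists i => //; rewrite !inE zy.
    by lia.
  exists (fun i => if i == i0 then y else g i); split.
  + have gy j : j \in D -> j != i0 -> g j <> y.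
      move=> jD ji eq; have := gF j; rewrite !inE ji jD eq eqxx /= => /(_ isT).
      by [].
    move=> i j iD jD; case: eqVneq => [->|ii]; case: eqVneq => [->|ji] // eq.
    * by case: (gy j).
    * by case: (gy i).
    * by apply: ginj; rewrite ?inE ?ii ?ji.
  + move=> i iD; case: eqVneq => [->|ii] //.
    by have := gF i; rewrite !inE ii iD => /(_ isT) /andP[].
Qed.
End Hall.

(** * Neighbourhoods and updated maps *)

Definition nbrs (G : sgraph) (u : G) : {set G} := [set y | adj u y].
Definition nbhd (G : sgraph) (S : {set G}) : {set G} := \bigcup_(u in S) nbrs u.

Lemma nbhdP (G : sgraph) (S : {set G}) y :
  reflect (exists2 u, u \in S & adj u y) (y \in nbhd S).
Proof.
apply: (iffP bigcupP) => [[u uS]|[u uS uy]]; first by rewrite inE; exists u.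
by exists u => //; rewrite inE.
Qed.

Definition upd (A : eqType) (B : Type) (f : A -> B) (a : A) (b : B) : A -> B :=
  fun t => if t == a then b else f t.

Lemma updE (A : eqType) (B : Type) (f : A -> B) a b : upd f a b a = b.
Proof. by rewrite /upd eqxx. Qed.

Lemma upd_neq (A : eqType) (B : Type) (f : A -> B) a b t : t != a -> upd f a b t = f t.
Proof. by rewrite /upd => /negbTE ->. Qed.

Lemma imset_upd (A B : finType) (f : A -> B) (X : {set A}) a b :
  a \in X -> upd f a b @: X = b |: f @: (X :\ a).
Proof.
move=> aX; rewrite -{1}(setD1K aX) imsetU1 updE; congr (_ |: _).
by apply: eq_in_imset => t; rewrite !inE => /andP[ta _]; rewrite upd_neq.
Qed.

Lemma imset_upd_notin (A B : finType) (f : A -> B) (X : {set A}) a b :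
  a \notin X -> upd f a b @: X = f @: X.
Proof.
move=> aX; apply: eq_in_imset => t tX; rewrite upd_neq //.
by apply: contraNneq aX => <-.
Qed.

Lemma cardsUD (A : finType) (B C : {set A}) : #|B :|: C| = #|B| + #|C :\: B|.
Proof.
rewrite cardsU cardsD setIC; have := subset_leq_card (subsetIl C B); lia.
Qed.

(** * Embedding rooted trees *)

Section RootedTree.
Variables (T : finType) (v : T) (par : T -> T) (dep : T -> nat).
Hypothesis par_root : par v = v.
Hypothesis dep_par : forall u, u != v -> dep (par u) < dep u.

Definition rooted (X : {set T}) := v \in X /\ {in X, forall u, par u \in X}.

Definition tleaf (X : {set T}) (u : T) :=
  [/\ u \in X, u != v & {in X, forall w, par w != u}].

Lemma par_neq u : u != v -> par u != u.
Proof. by move=> uv; apply/eqP=> eq; have := dep_par uv; rewrite eq ltnn. Qed.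

Lemma rooted_leaf (X : {set T}) u0 : u0 \in X -> u0 != v -> exists u, tleaf X u.
Proof.
move=> u0X u0v.
have P0 : (u0 \in X) && (u0 != v) by rewrite u0X.
case: (arg_maxnP (P := fun u => (u \in X) && (u != v)) dep P0) => u /andP[uX uv] maxu.
exists u; split=> // w wX; apply/eqP=> eq.
have wv : w != v by apply: contraNneq uv => wv; rewrite -eq wv par_root.
by have := maxu w; rewrite wX wv => /(_ isT) /=; have := dep_par wv; rewrite eq; lia.
Qed.

Lemma rooted_rem (X : {set T}) u : rooted X -> tleaf X u -> rooted (X :\ u).
Proof.
move=> [vX parX] [uX uv chu]; split; first by rewrite !inE eq_sym uv.
by move=> w; rewrite !inE => /andP[_ wX]; rewrite parX // chu.
Qed.

Section Embedding.
Variables (G : sgraph) (x : G).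

Definition tree_emb (X : {set T}) (f : T -> G) :=
  [/\ f v = x, {in X &, injective f} &
      {in X, forall u, u != v -> par u \in X -> adj (f (par u)) (f u)}].

Lemma emb_sub (X Y : {set T}) f : Y \subset X -> tree_emb X f -> tree_emb Y f.
Proof.
move=> /subsetP sYX [fv finj fadj]; split=> //; first exact: sub_in2 finj.
by move=> u uY uv pY; apply: fadj => //; apply: sYX.
Qed.

Lemma emb_upd (X : {set T}) f w y :
  tree_emb (X :\ w) f -> w \in X -> w != v -> y \notin f @: (X :\ w) ->
  (par w \in X -> adj (f (par w)) y) ->
  (forall c, c \in X -> c != v -> par c = w -> adj y (f c)) -> tree_emb X (upd f w y).
Proof.
move=> [fv finj fadj] wX wv yf pw chw.
have yN t : t \in X -> t != w -> y <> f t.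
  by move=> tX tw eq; case/negP: yf; rewrite eq imset_f // !inE tw.
split; first by rewrite upd_neq // eq_sym.
  move=> s t sX tX; rewrite /upd; case: eqVneq => [->|sw]; case: eqVneq => [->|tw] //.
  - by move/yN => /(_ tX tw).
  - by move/esym/yN => /(_ sX sw).
  - by apply: finj; rewrite !inE ?sw ?tw.
move=> u uX uv pX; case: (eqVneq u w) => [eqw|uw].
  by rewrite eqw updE upd_neq ?par_neq // pw // -eqw.
rewrite [upd f w y u]upd_neq //; case: (eqVneq (par u) w) => [eqw|pw'].
  by rewrite eqw updE chw.
by rewrite upd_neq // fadj // !inE ?uw ?pw'.
Qed.

Lemma emb_upd_leaf (X : {set T}) f w y :
  tree_emb (X :\ w) f -> tleaf X w -> y \notin f @: (X :\ w) ->
  adj (f (par w)) y -> tree_emb X (upd f w y).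
Proof.
move=> embf [wX wv chw] yf pw; apply: emb_upd => // c cX _ eq.
by have := chw c cX; rewrite eq eqxx.
Qed.

Lemma emb_upd_full (X : {set T}) f w y :
  tree_emb (X :\ w) f -> w \in X -> w != v ->
  (forall t, t \in X -> t != w -> adj y (f t)) -> tree_emb X (upd f w y).
Proof.
move=> ef wX wv yf; apply: emb_upd => //.
- apply/imsetP=> [[t]]; rewrite !inE => /andP[tw tX] eq.
  by have := yf t tX tw; rewrite eq adj_irrefl.
- by move=> pX; rewrite adj_sym yf // par_neq.
- by move=> c cX cv eq; apply: yf => //; rewrite -eq eq_sym par_neq.
Qed.

(** The parent of the leaf [w] moves to [e] and [w] inherits the old place of its parent. Nothing is
    asked about [e] and [f w], so [e = f w] is allowed; then the two images are exchanged. *)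
Lemma emb_shift (X : {set T}) f w e :
  tleaf X w -> par w \in X -> par w != v -> tree_emb X f ->
  (forall t, t \in X -> t != w -> adj e (f t)) ->
  tree_emb X (upd (upd f (par w) e) w (f (par w))).
Proof.
move=> lw pX pv ef ae; have [wX wv _] := lw; have pw := par_neq wv.
have pXw : par w \in X :\ w by rewrite in_setD1 pw.
have [_ finj _] := ef.
have ef1 : tree_emb (X :\ w :\ par w) f.
  by apply: emb_sub ef; apply: subset_trans (subsetDl _ _) (subsetDl _ _).
have ef2 : tree_emb (X :\ w) (upd f (par w) e).
  by apply: emb_upd_full => // t /setD1P[tw tX] _; apply: ae.
apply: emb_upd_leaf => //; last by rewrite updE ae.
rewrite imset_upd // in_setU1 negb_or; apply/andP; split.
  by apply: contraTneq (ae _ pX pw) => ->; rewrite adj_irrefl.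
apply/imsetP=> [[t /setD1P[tp /setD1P[_ tX]] /finj e']].
by rewrite e' ?eqxx // in tp.
Qed.

(** Greedy placement, leaves last. Degree [#|X| - 1] is enough because the image of the parent is
    used but is not its own neighbour. *)
Lemma emb_exists (X : {set T}) :
  rooted X -> (forall u : G, #|X| <= #|nbrs u|.+1) -> exists f, tree_emb X f.
Proof.
have [n] := ubnP #|X|; elim: n X => // n IHn X leX rX degX.
case: (pickP (fun u => (u \in X) && (u != v))) => [u0 /andP[u0X u0v]|X1]; last first.
  have Xv u : u \in X -> u = v.
    by move=> uX; apply/eqP; have := X1 u; rewrite uX /= => /negbFE.
  exists (fun=> x); split=> // [s t /Xv-> /Xv-> //|u /Xv ->].
  by rewrite eqxx.
have [u lu] := rooted_leaf u0X u0v; have [uX uv chu] := lu.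
have cX : #|X| = #|X :\ u|.+1 by rewrite (cardsD1 u X) uX.
have [|||f embf] := IHn (X :\ u); first by lia.
- exact: rooted_rem.
- by move=> w; have := degX w; lia.
have [fv finj fadj] := embf.
have pu : par u \in X :\ u by rewrite !inE par_neq // (proj2 rX).
have [y /setDP[yN yf]] : exists y, y \in nbrs (f (par u)) :\: f @: (X :\ u).
  apply/card_gt0P; rewrite cardsD.
  have : nbrs (f (par u)) :&: f @: (X :\ u) \subset (f @: (X :\ u)) :\ f (par u).
    apply/subsetP=> y; rewrite !inE => /andP[py ->]; rewrite andbT.
    by apply/eqP=> eq; rewrite eq adj_irrefl in py.
  move/subset_leq_card; have := cardsD1 (f (par u)) (f @: (X :\ u)).
  rewrite imset_f // card_in_imset //.
  by have := degX (f (par u)); lia.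
by exists (upd f u y); apply: emb_upd_leaf => //; rewrite inE in yN.
Qed.

(* Both vertices being joined to the whole image, exchanging them breaks no edge. *)
Lemma emb_swap (X : {set T}) f a b :
  tree_emb X f -> a \in X -> b \in X -> a != v -> b != v ->
  {in X, forall t, t != a -> adj (f a) (f t)} ->
  {in X, forall t, t != b -> adj (f b) (f t)} -> tree_emb X (f \o tperm a b).
Proof.
move=> [fv finj fadj] aX bX av bv fa fb.
have tX t : t \in X -> tperm a b t \in X by case: tpermP => // ->.
have fa' t : t \in X -> t != a -> adj (f t) (f a) by move=> *; rewrite adj_sym fa.
have fb' t : t \in X -> t != b -> adj (f t) (f b) by move=> *; rewrite adj_sym fb.
split; first by rewrite /= tpermD // eq_sym.
  by move=> s t sX tX' /finj /perm_inj; apply; apply: tX.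
move=> u uX uv pX /=; have pu := par_neq uv.
have tpu : tperm a b (par u) != tperm a b u by rewrite (inj_eq perm_inj).
case: (tpermP a b u) tpu => [_ | _ | ua ub] tpu.
- by apply: fb'; rewrite ?tX.
- by apply: fa'; rewrite ?tX.
- move: tpu; case: tpermP => [_ | _ | _ _] tpu; rewrite ?fa ?fb ?fadj // eq_sym //.
Qed.

(* [X] stands for the root and the non-leaves: the vertices outside [X] are leaves, and
   the bearers are the preleaves other than the root. *)
Definition twigs (X I : {set T}) := [set l in ~: X | par l \in I].
Definition bearers (X : {set T}) := par @: (~: X) :\ v.

(** Every leaf chooses among the free neighbours of its parent's image. Leaves with the same parent
    have the same choices, so a violating set of leaves can be enlarged to all leaves at a set [I]
    of parents. *)
Lemma hall_violator (X : {set T}) f :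
  rooted X -> (forall l, l \notin X -> par l \in X) -> tree_emb X f -> #|T| <= #|nbrs x|.+1 ->
  (exists g, tree_emb setT g) \/
  exists I : {set T}, [/\ I \subset bearers X, I != set0 &
    #|f @: X :|: nbhd (f @: I)| < #|X| + #|twigs X I|].
Proof.
move=> [vX parX] leafX [fv finj fadj] xdeg.
pose F l := nbrs (f (par l)) :\: f @: X.
have cfX : #|f @: X| = #|X| by rewrite card_in_imset.
case: (pickP [pred J : {set T} | (J \subset ~: X) && (#|\bigcup_(l in J) F l| < #|J|)])
  => [J /andP[JX ltJ]|noJ]; last first.
  have [|g [ginj gF]] := hall_marriage x (F := F) (D := ~: X).
    by move=> J JX; have := noJ J; rewrite /= JX /= => /negbT; rewrite -leqNgt.
  left; exists (fun u => if u \in X then f u else g u); split.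
  - by rewrite vX.
  - have fg s t : s \in X -> t \notin X -> f s <> g t.
      move=> sX tX eq; have := gF t; rewrite in_setC => /(_ tX).
      by rewrite -eq inE imset_f.
    move=> s t _ _; case: ifPn => sX; case: ifPn => tX eq.
    + exact: finj.
    + by case: (fg s t).
    + by case: (fg t s).
    + by apply: ginj; rewrite ?in_setC.
  - move=> u _ uv _; case: (boolP (u \in X)) => uX; first by rewrite parX ?fadj ?parX.
    by rewrite leafX //; have := gF u; rewrite !inE => /(_ uX) /andP[].
right; exists (par @: J).
have Jtw : J \subset twigs X (par @: J).
  apply/subsetP=> l lJ; rewrite inE imset_f // andbT; exact: (subsetP JX).
have FE : \bigcup_(l in J) F l = nbhd (f @: (par @: J)) :\: f @: X.
  apply/setP=> y; apply/bigcupP/idP => [[l lJ]|].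
    rewrite !inE => /andP[-> /= ly]; apply/nbhdP.
    by exists (f (par l)) => //; rewrite !imset_f.
  case/setDP=> /nbhdP[_ /imsetP[_ /imsetP[l lJ ->] ->] ly] yf.
  by exists l => //; rewrite !inE yf.
split.
(* The degree of [x] leaves at least as many free neighbours as there are vertices outside [X], so a
   set of leaves containing one at the root never violates Hall's condition. *)
- apply/subsetP=> w wJ; rewrite inE (subsetP (imsetS par JX)) // andbT inE.
  apply/eqP=> wv; move: ltJ; rewrite FE ltnNge => /negP[].
  have cJ : #|J| <= #|T| - #|X| by have := subset_leq_card JX; have := cardsC X; lia.
  have : nbrs x :\: f @: X \subset nbhd (f @: (par @: J)) :\: f @: X.
    apply: setSD; apply/subsetP=> y; rewrite inE => xy; apply/nbhdP; exists x => //.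
    by rewrite -fv -wv imset_f.
  move/subset_leq_card; rewrite {1}cardsD.
  have : nbrs x :&: f @: X \subset (f @: X) :\ x.
    apply/subsetP=> y; rewrite !inE => /andP[xy ->]; rewrite andbT.
    by apply/eqP=> eq; rewrite eq adj_irrefl in xy.
  move/subset_leq_card; have := cardsD1 x (f @: X).
  have -> : x \in f @: X by rewrite -fv imset_f.
  lia.
- have J0 : J != set0 by rewrite -card_gt0; lia.
  have [l lJ] := set0Pn _ J0; apply/set0Pn; exists (par l); exact: imset_f.
- rewrite FE in ltJ; have := subset_leq_card Jtw.
  by have := cardsUD (f @: X) (nbhd (f @: (par @: J))); lia.
Qed.
End Embedding.
End RootedTree.

(* [lia] slows down exponentially in the number of membership hypotheses. *)
Ltac arith :=
  repeat match goal with
  | H : is_true ?b |- _ => lazymatch b with leq _ _ => fail | _ => clear H end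
  end; lia.

(** * Edge counts in locally dense graphs *)

Lemma notin_nbrs (G : sgraph) (u : G) : u \notin nbrs u.
Proof. by rewrite inE adj_irrefl. Qed.

Lemma nbrs_sub_nbhd (G : sgraph) (S : {set G}) u : u \in S -> nbrs u \subset nbhd S.
Proof. exact: (bigcup_sup u). Qed.

Lemma nbhd1 (G : sgraph) (u : G) : nbhd [set u] = nbrs u.
Proof. exact: big_set1. Qed.

Lemma nbhd1U (G : sgraph) (y : G) (S : {set G}) : nbhd (y |: S) = nbrs y :|: nbhd S.
Proof. by rewrite /nbhd bigcup_setU big_set1. Qed.

Lemma nbhdS (G : sgraph) (S S' : {set G}) : S \subset S' -> nbhd S \subset nbhd S'.
Proof. by move/subsetP=> sS; apply/bigcupsP=> u /sS; apply: nbrs_sub_nbhd. Qed.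

(* Every nonempty vertex set meets more than [(k - 1)|S|/2] edges. *)
Definition locally_dense (G : sgraph) (k : nat) := forall S : {set G}, S != set0 ->
  k * #|S| < \sum_(u in S) (#|nbrs u| + #|nbrs u :\: S|) + #|S|.

Section Dense.
Variables (G : sgraph) (k : nat).
Hypothesis denseG : locally_dense G k.

Lemma card_nbrs_in (Z : {set G}) (u : G) : u \in Z -> nbrs u \subset Z -> #|nbrs u| < #|Z|.
Proof.
move=> uZ NZ; apply: proper_card; rewrite properE NZ; apply/subsetPn.
by exists u => //; apply: notin_nbrs.
Qed.

Lemma card_nbrs_out (S Z : {set G}) (u : G) :
  S \subset Z -> nbrs u \subset Z -> #|nbrs u :\: S| <= #|Z| - #|S|.
Proof.
move=> SZ NZ; have <- : #|Z :\: S| = #|Z| - #|S| by rewrite cardsD (setIidPr SZ).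
by apply: subset_leq_card; apply: setSD.
Qed.

(** Each vertex of [S] has at most [#|Z| - 1] neighbours, at most [#|Z| - #|S|] of them outside [S].
    Divide the local density inequality by [#|S|]. *)
Lemma closed_bound (S Z : {set G}) :
  S != set0 -> S \subset Z -> nbhd S \subset Z -> k + #|S| < 2 * #|Z|.
Proof.
move=> S0 SZ NZ; have := denseG S0.
have le : \sum_(u in S) (#|nbrs u| + #|nbrs u :\: S|)
    <= \sum_(u in S) (#|Z|.-1 + (#|Z| - #|S|)).
  apply: leq_sum => u uS; have NuZ := subset_trans (nbrs_sub_nbhd uS) NZ.
  have := card_nbrs_in (subsetP SZ _ uS) NuZ; have := card_nbrs_out SZ NuZ; lia.
move: le; rewrite sum_nat_const.
have := subset_leq_card SZ; rewrite -card_gt0 in S0; nia.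
Qed.

Lemma min_degree (u : G) : k <= 2 * #|nbrs u|.
Proof.
have := denseG (S := [set u]); rewrite -card_gt0 cards1 big_set1 muln1 => /(_ isT).
have := subset_leq_card (subsetDl (nbrs u) [set u]); lia.
Qed.
End Dense.

(** * Stuck embeddings of the core *)

Section Core.
Variables (T : finType) (v : T) (par : T -> T) (dep : T -> nat).
Hypothesis par_root : par v = v.
Hypothesis dep_parS : forall u, u != v -> dep u = (dep (par u)).+1.
Variables (T0 : {set T}) (k : nat).
Hypothesis rT0 : rooted v par T0.
Hypothesis twigP : forall l, l \notin T0 -> par l \in T0.
Hypothesis bearP : forall u, tleaf v par T0 u -> u \in bearers v par T0.
Hypothesis cardT : #|T| = k.+1.
Variables (G : sgraph) (x : G).
Hypothesis denseG : locally_dense G k.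
Hypothesis xdeg : k <= #|nbrs x|.
Hypothesis noT : forall z g, ~ tree_emb v par (z : G) setT g.

Notation emb := (tree_emb v par x).
Notation tleaf := (tleaf v par).
Notation U := (bearers v par T0).
Notation twigs := (twigs par T0).
Notation q := (#|U|).

(* [N - 1] is the number of edges left once the twigs of the root are removed. *)
Notation N := (#|T0| + #|twigs U|).

Let dep_par u : u != v -> dep (par u) < dep u.
Proof. by move/dep_parS->. Qed.

Lemma bearers_T0 u : u \in U -> (u \in T0) && (u != v).
Proof.
by rewrite in_setD1 => /andP[-> /imsetP[l]]; rewrite inE => lT0 ->; rewrite twigP.
Qed.

Lemma sub_bearers_T0 (I : {set T}) : I \subset U -> I \subset T0.
Proof. by move/subsetP=> IU; apply/subsetP=> u /IU /bearers_T0 /andP[]. Qed.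

Lemma in_twigs I l : (l \in twigs I) = (l \notin T0) && (par l \in I).
Proof. by rewrite in_set in_setC. Qed.

(** Each bearer outside [I] carries a leaf that [twigs I] misses. *)
Lemma twigs_loss (I : {set T}) : I \subset U -> #|twigs I| + q <= #|twigs U| + #|I|.
Proof.
move=> IU; have cU : q = #|I| + #|U :\: I|.
  by rewrite -cardsUD setUC (setUidPl IU).
have le1 : #|U :\: I| <= #|twigs (U :\: I)|.
  apply: leq_trans (leq_imset_card par _); apply: subset_leq_card.
  apply/subsetP=> u /[dup] uUI /setDP[uU _]; have := uU.
  rewrite in_setD1 => /andP[_ /imsetP[l lT0 eu]]; apply/imsetP; exists l => //.
  by rewrite in_twigs -eu uUI andbT -in_setC.
have : twigs I :|: twigs (U :\: I) \subset twigs U.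
  apply/subsetP=> l /setUP[]; rewrite !in_twigs => /andP[->] /=; first exact: (subsetP IU).
  by case/setDP.
move/subset_leq_card; rewrite cardsU.
have -> : twigs I :&: twigs (U :\: I) = set0.
  by apply/setP=> l; rewrite in_setI !in_twigs in_setD in_set0; case: (par l \in I); rewrite ?andbF.
rewrite cards0; lia.
Qed.

(** The same set is bounded above by the failure of Hall's condition and below by local density; all
    later cases exploit how close these bounds are. *)
Lemma stuck f : emb T0 f -> exists I : {set T},
  [/\ I \subset U, I != set0, #|f @: T0 :|: nbhd (f @: I)| < #|T0| + #|twigs I| &
      k + #|I| < 2 * #|f @: T0 :|: nbhd (f @: I)|].
Proof.
move=> ef; have [||[g /noT //]|[I [IU I0 small]]] := hall_violator rT0 _ ef.
- exact: twigP.
- by rewrite cardT ltnS.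
exists I; split=> //; have [_ finj _] := ef.
have IT0 := sub_bearers_T0 IU.
have <- : #|f @: I| = #|I| by rewrite card_in_imset //; apply: sub_in2 finj; apply/subsetP.
apply: closed_bound => //; last exact: subsetUr.
  by rewrite -card_gt0 card_in_imset ?card_gt0 //; apply: sub_in2 finj; apply/subsetP.
by rewrite subsetU // imsetS.
Qed.

Lemma min_deg (u : G) : k <= 2 * #|nbrs u|. Proof. exact: min_degree. Qed.

Lemma exists_tleaf : U != set0 -> exists u, tleaf T0 u.
Proof.
by case/set0Pn=> u /bearers_T0 /andP[uT0 uv]; apply: (rooted_leaf par_root dep_par uT0).
Qed.

Section LastVertex.
Variable u1 : T.
Hypothesis lu1 : tleaf T0 u1.
Notation X1 := (T0 :\ u1).
Notation K := (U :\ u1).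

Lemma rX1 : rooted v par X1. Proof. exact: rooted_rem. Qed.
Lemma u1U : u1 \in U. Proof. exact: bearP. Qed.
Lemma cardK : q = #|K|.+1. Proof. by rewrite (cardsD1 u1) u1U. Qed.
Lemma cardX1 : #|T0| = #|X1|.+1. Proof. by rewrite (cardsD1 u1); case: lu1 => ->. Qed.
Lemma subKX1 : K \subset X1.
Proof. exact/setSD/sub_bearers_T0. Qed.
Lemma par_u1 : par u1 \in X1.
Proof. by have [uT uv _] := lu1; rewrite in_setD1 (par_neq dep_par uv) (proj2 rT0 _ uT). Qed.

(* [spots f] are the places left for [u1] once [f] has embedded the rest of the core. *)
Definition spots (f : T -> G) := nbrs (f (par u1)) :\: f @: X1.
(** The part of the set in Hall's condition that does not depend on the place of [u1]. *)
Definition zone (f : T -> G) (I : {set T}) := f @: X1 :|: nbhd (f @: I).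

Lemma card_embX1 f (I : {set T}) : emb X1 f -> I \subset X1 -> #|f @: I| = #|I|.
Proof. by move=> [_ finj _] /subsetP IX; rewrite card_in_imset //; apply: sub_in2 finj. Qed.

Lemma card_spots f : emb X1 f -> #|nbrs (f (par u1))| + 2 <= #|spots f| + #|T0|.
Proof.
move=> ef; rewrite /spots cardsD.
have : nbrs (f (par u1)) :&: f @: X1 \subset f @: X1 :\ f (par u1).
  apply/subsetP=> y; rewrite !inE => /andP[py ->]; rewrite andbT.
  by apply/eqP=> eq; rewrite eq adj_irrefl in py.
move/subset_leq_card; have := cardsD1 (f (par u1)) (f @: X1).
rewrite imset_f ?par_u1 // (card_embX1 ef) // cardX1; lia.
Qed.

Lemma emb_spot f y : emb X1 f -> y \in spots f -> emb T0 (upd f u1 y).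
Proof. by move=> ef /setDP[]; rewrite inE => py yf; apply: (emb_upd_leaf dep_par). Qed.

Lemma zone_bound f (I : {set T}) (Z : {set G}) : emb X1 f -> I \subset X1 -> I != set0 ->
  f @: I \subset Z -> nbhd (f @: I) \subset Z -> k + #|I| < 2 * #|Z|.
Proof.
move=> ef IX I0 IZ NZ; rewrite -(card_embX1 ef IX); apply: closed_bound => //.
by rewrite -card_gt0 (card_embX1 ef IX) card_gt0.
Qed.

(* The last vertex [u1] sits at [y]: the violating set contains it or not. *)
Lemma stuck_spot f y : emb X1 f -> y \in spots f ->
  exists2 I : {set T}, I \subset K &
   [/\ I != set0, #|y |: zone f I| < #|T0| + #|twigs I| & k + #|I| < 2 * #|y |: zone f I|] \/
   #|(y |: nbrs y) :|: zone f I| < #|T0| + #|twigs (u1 |: I)| /\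
   k + #|I|.+1 < 2 * #|(y |: nbrs y) :|: zone f I|.
Proof.
move=> ef ys; have [I [IU I0 small large]] := stuck (emb_spot ef ys).
exists (I :\ u1); first exact: setSD.
have [u1T _ _] := lu1.
rewrite !(imset_upd _ _ u1T) in small large.
case: (boolP (u1 \in I)) => u1I; [right|left].
  rewrite setD1K //; rewrite !(imset_upd _ _ u1I) !nbhd1U in small large.
  have -> : (y |: nbrs y) :|: zone f (I :\ u1) =
      (y |: f @: X1) :|: (nbrs y :|: nbhd (f @: (I :\ u1))) by rewrite setUACA.
  by split=> //; rewrite (cardsD1 u1 I) u1I in large.
have -> : I :\ u1 = I by apply/setDidPl; rewrite disjoint_sym disjoints1.
by rewrite !imset_upd_notin // in small large; rewrite /zone setUA.
Qed.

Lemma zone_sub f (I J : {set T}) : I \subset J -> zone f I \subset zone f J.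
Proof. by move=> IJ; apply: setUS; apply/nbhdS/imsetS. Qed.

Lemma zone_large f (I : {set T}) : emb X1 f -> I \subset K -> I != set0 ->
  k + #|I| < 2 * #|zone f I|.
Proof.
move=> ef IK I0; have IX := subset_trans IK subKX1.
by apply: (zone_bound ef IX I0); rewrite ?subsetUr // subsetU // imsetS.
Qed.

(** The images of [I] are closed in the zone by construction; [S] adds further closed vertices. An
    upper bound on the zone thus limits [#|S|]. *)
Lemma zone_capacity f (I : {set T}) (S : {set G}) : emb X1 f -> I \subset K ->
  S \subset zone f I -> nbhd S \subset zone f I -> [disjoint S & f @: I] -> S != set0 ->
  k + #|I| + #|S| < 2 * #|zone f I|.
Proof.
move=> ef IK SZ NS dis S0; have IX := subset_trans IK subKX1.
rewrite -(card_embX1 ef IX).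
have -> : k + #|f @: I| + #|S| = k + #|S :|: f @: I|.
  by rewrite cardsU disjoint_setI0 // cards0; lia.
apply: closed_bound => //.
- by apply: contraNneq S0 => eq; rewrite -subset0 -eq subsetUl.
- by rewrite subUset SZ subsetU // imsetS.
- by rewrite /nbhd bigcup_setU subUset NS subsetUr.
Qed.

Lemma spots_disjoint f (I : {set T}) : emb X1 f -> I \subset X1 -> [disjoint spots f & f @: I].
Proof.
move=> ef IX; apply/pred0P=> y /=; apply/negbTE/negP=> /andP[/setDP[_ yf] yI].
by case/negP: yf; apply: (subsetP (imsetS f IX)).
Qed.
End LastVertex.

(** * Slack in the count, and a single bearer *)

Lemma emb_start X : rooted v par X -> 2 * #|X| <= k + 3 -> exists f, emb X f.
Proof.
move=> rX leX; apply: (emb_exists par_root dep_par) => // u.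
by have := min_deg u; lia.
Qed.

(** Only the full set [U] can violate Hall's condition, and by rounding the zone cannot grow, so
    every spot is closed in it. There are at least two spots, but
    [k + (q - 1) + 2 < 2 * #|Z| <= k + q + 1] is impossible. *)
Lemma many_twigs_case : 2 <= q -> 2 * N <= k + q + 3 -> False.
Proof.
move=> q2 leN; have [u1 lu1] : exists u1, tleaf T0 u1.
  by apply: exists_tleaf; rewrite -card_gt0; lia.
have cK := cardK lu1; have cX := cardX1 lu1.
have tU := twigs_loss (sub0set U); rewrite cards0 in tU.
have [f ef] : exists f, emb (T0 :\ u1) f.
  by apply: emb_start; [exact: rX1 | lia].
have K0 : U :\ u1 != set0 by rewrite -card_gt0; lia.
have large := zone_large ef (subxx _) K0.
set Z := zone u1 f (U :\ u1) in large.
have full y : y \in spots u1 f -> y |: nbrs y \subset Z /\ #|Z| < N.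
  move=> ys; have [I IK] := stuck_spot lu1 ef ys.
  have iK := subset_leq_card IK.
  have IU := subset_trans IK (subsetDl _ _).
  case=> [[I0 small big]|[small big]]; first by have := twigs_loss IU; lia.
  have u1I : u1 |: I \subset U by rewrite subUset sub1set (u1U lu1).
  have cI : #|u1 |: I| = #|I|.+1.
    by rewrite cardsU1; case: (boolP (u1 \in I)) => // /(subsetP IK); rewrite !inE eqxx.
  have tw := twigs_loss u1I.
  have eI : I = U :\ u1 by apply/eqP; rewrite eqEcard IK; lia.
  rewrite eI in small tw cI.
  have eZ : Z = (y |: nbrs y) :|: Z.
    by apply/eqP; rewrite eqEcard subsetUr; rewrite /Z in large *; lia.
  split; first by rewrite eZ subsetUl.
  by have := subset_leq_card (subsetUr (y |: nbrs y) (zone u1 f (U :\ u1))); rewrite /Z; lia.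
have cS := card_spots lu1 ef; have dR := min_deg (f (par u1)).
have S0 : spots u1 f != set0 by rewrite -card_gt0; lia.
have [y ys] := set0Pn _ S0.
have := zone_capacity ef (subxx _) (S := spots u1 f) _ _ _ S0.
have -> : spots u1 f \subset zone u1 f (U :\ u1).
  by apply/subsetP=> z /full[/subsetP sZ _]; apply: sZ; rewrite !inE eqxx.
have -> : nbhd (spots u1 f) \subset zone u1 f (U :\ u1).
  by apply/bigcupsP=> z /full[+ _]; rewrite subUset => /andP[].
move=> /(_ isT isT (spots_disjoint ef (subKX1 u1))).
have [_] := full _ ys; rewrite -/Z; lia.
Qed.

Lemma card_twigs : k.+1 = #|T0| + #|twigs [set v]| + #|twigs U|.
Proof.
rewrite -cardT -(cardsC T0) -addnA; congr (_ + _).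
have -> : ~: T0 = twigs [set v] :|: twigs U.
  apply/setP=> l; rewrite in_setU !in_twigs in_setC in_set1 in_setD1.
  case: (boolP (l \in T0)) => //= lT0.
  by case: eqP => //= _; rewrite imset_f // in_setC.
rewrite cardsU; have -> : twigs [set v] :&: twigs U = set0.
  apply/setP=> l; rewrite in_setI !in_twigs in_set1 in_setD1 in_set0.
  by case: eqP; rewrite ?andbF.
by rewrite cards0 subn0.
Qed.

(* Exchanging [u1] with the other vertices shows that every vertex of the image except [x]
   is joined to the whole image and has minimum degree: together they meet too few edges. *)
Lemma single_bearer_case : #|twigs U| <= #|twigs [set v]| -> q = 1 ->
  2 * N <= k + q + 4 -> False.
Proof.
move=> leab q1 leN.
have [u1 lu1] : exists u1, tleaf T0 u1 by apply: exists_tleaf; rewrite -card_gt0 q1.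
have [u1T u1v _] := lu1.
have eU : U = [set u1].
  have [w eU] := cards1P (introT eqP q1); have := u1U lu1; rewrite eU.
  by rewrite inE => /eqP ->.
have ct := card_twigs.
have tU := twigs_loss (sub0set U); rewrite cards0 in tU.
have cX := cardX1 lu1.
have [f0 ef0] : exists f, emb T0 f by apply: emb_start => //; lia.
have uni f : emb T0 f -> [/\ {in T0, forall t, t != u1 -> adj (f u1) (f t)},
    #|nbrs (f u1)| + 2 = N & k + 3 < 2 * N].
  move=> ef; have [I [IU I0 small large]] := stuck ef.
  have eI : I = [set u1].
    by apply/eqP; rewrite eqEcard -eU IU q1 card_gt0.
  rewrite eI imset_set1 /nbhd big_set1 cards1 -eU in small large.
  have sub : f u1 |: nbrs (f u1) \subset f @: T0 :|: nbrs (f u1).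
    by rewrite setSU // sub1set imset_f.
  have cN : #|f u1 |: nbrs (f u1)| = #|nbrs (f u1)|.+1 by rewrite cardsU1 notin_nbrs.
  have := subset_leq_card sub; have := min_deg (f u1); rewrite cN => d1 d2.
  have eZ : f u1 |: nbrs (f u1) = f @: T0 :|: nbrs (f u1).
    by apply/eqP; rewrite eqEcard sub cN; lia.
  split; [|by rewrite -eZ cN in small large *; lia..].
  move=> t tT tu1; have : f t \in f u1 |: nbrs (f u1) by rewrite eZ inE imset_f.
  rewrite !inE => /orP[/eqP eq|//]; have [_ finj _] := ef.
  by case/eqP: tu1; apply: finj.
have [un0 _ kN] := uni _ ef0.
(* The choice of [v] enters here: the leaves at [u1] do not outnumber those at the root. *)
have n3 : 3 <= #|T0| by lia.
pose r := par u1.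
have rX : r \in T0 :\ u1 by apply: par_u1.
have rT : r \in T0 by case/setD1P: rX.
have ru1 : r != u1 by case/setD1P: rX.
(* If [u1] hung from the root, a further leaf of [T0 :\ u1] would be a leaf of [T0] as well, hence a
   second bearer. *)
have rv : r != v.
  have [w] : exists w, w \in T0 :\ u1 :\ v.
    by apply/card_gt0P; have := cardsD1 v (T0 :\ u1); lia.
  case/setD1P=> wv wX; have [w' [w'X w'v chw']] := rooted_leaf par_root dep_par wX wv.
  have [w'u1 w'T] := setD1P w'X.
  apply: contra w'u1 => /eqP rv; rewrite -in_set1 -eU; apply: bearP; split=> // c cT.
  case: (eqVneq c u1) => [->|cu1]; last by apply: chw'; rewrite !inE cu1.
  by rewrite -/r rv eq_sym.
(* The images of [t] and [u1] are exchanged. The parent of [u1] then sits at [f0 r], or at [f0 u1]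
   if [t] is that parent. The case [t = r] comes first, as it shows that [f0 r] is joined to all
   other images. *)
have swap t : t \in T0 -> t != v -> t != u1 -> adj (f0 (if t == r then u1 else r)) (f0 t) ->
    emb T0 (upd (upd f0 t (f0 u1)) u1 (f0 t)).
  move=> tT tv tu1 rt; have [_ finj _] := ef0.
  have tX : t \in T0 :\ u1 by rewrite !inE tu1.
  apply: emb_spot => //.
    apply: (emb_upd_full dep_par) => //.
      by apply: emb_sub ef0; apply: subset_trans (subsetDl _ _) (subsetDl _ _).
    by move=> s /setD1P[su1 sT] st; apply: un0.
  rewrite !inE {2}/upd -/r; case: ifP rt => [/eqP ->|rt]; rewrite ?eqxx.
    move=> ->; rewrite andbT; apply/imsetP=> [[s /setD1P[su1 sT]]].
    rewrite /upd; case: eqP => [_|/eqP sr] /finj eq; first by rewrite eq ?eqxx // in ru1.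
    by rewrite eq ?eqxx // in sr.
  rewrite eq_sym rt => ->; rewrite andbT; apply/imsetP=> [[s /setD1P[su1 sT]]].
  rewrite /upd; case: eqP => [_|/eqP sr] /finj eq; first by rewrite eq ?eqxx // in tu1.
  by rewrite eq ?eqxx // in sr.
have uni1 t : emb T0 (upd (upd f0 t (f0 u1)) u1 (f0 t)) -> t \in T0 -> t != u1 ->
   {in T0, forall s, s != t -> adj (f0 t) (f0 s)} /\ #|nbrs (f0 t)| + 2 = N.
  move=> /uni[adj1 card1 _] tT tu1; rewrite updE in adj1 card1; split=> // s sT st.
  case: (eqVneq s u1) => [->|su1]; first by rewrite adj_sym un0.
  by have := adj1 s sT su1; rewrite upd_neq // upd_neq.
have un1 : {in T0, forall s, s != r -> adj (f0 r) (f0 s)}.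
  by apply: (proj1 (uni1 r _ rT ru1)); apply: swap => //; rewrite eqxx un0.
have all_uni t : t \in T0 -> t != v ->
   {in T0, forall s, s != t -> adj (f0 t) (f0 s)} /\ #|nbrs (f0 t)| + 2 = N.
  move=> tT tv; case: (eqVneq t u1) => [->|tu1]; first by have [] := uni _ ef0.
  apply: uni1 => //; apply: swap => //; case: (eqVneq t r) => [->|tr]; first exact: un0.
  by apply: un1.
have [f0v finj _] := ef0.
pose S := f0 @: (T0 :\ v).
have finjS : {in T0 :\ v &, injective f0}.
  by apply: sub_in2 finj => t /setD1P[].
have cS : #|S|.+1 = #|T0| by rewrite card_in_imset // (cardsD1 v T0) (proj1 rT0).
have S0 : S != set0 by rewrite -card_gt0; lia.
have := denseG S0.
have le : \sum_(u in S) (#|nbrs u| + #|nbrs u :\: S|) <= \sum_(u in S) ((N - 2) + (N - 1 - #|S|)).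
  apply: leq_sum => _ /imsetP[t /setD1P[tv tT] ->]; have [adjt degt] := all_uni t tT tv.
  rewrite cardsD; have : S :\ f0 t \subset nbrs (f0 t) :&: S.
    apply/subsetP=> y /setD1P[yt yS]; rewrite inE yS andbT.
    have [s /setD1P[sv sT] eq] := imsetP yS; rewrite inE eq; apply: adjt => //.
    by apply: contraNneq yt => <-; rewrite eq.
  move/subset_leq_card; have := cardsD1 (f0 t) S; rewrite imset_f ?inE ?tv //; lia.
(* The count reads [k < 2 * N - 2 - #|S|]. For [#|S| >= 3] this contradicts [2 * N <= k + 5]; for
   [#|S| = 2] the comparison of the leaves at [u1] and at [v] gives [2 * N <= k + 4]. *)
move: le; rewrite sum_nat_const; nia.
Qed.

(** * Three or more bearers *)

Lemma setU1D1D1 (A : finType) (X : {set A}) a b : a \in X -> b != a -> a |: X :\ a :\ b = X :\ b.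
Proof.
move=> aX ba; apply/setP=> t; rewrite !(in_setU1, in_setD1).
by case: (eqVneq t a) => // ->; rewrite aX eq_sym ba.
Qed.

(** The two bounds leave at most one bearer outside the violating set: it is [u1], or there is none,
    or it is another bearer [j]. *)
Lemma spot_types u1 f y : 2 <= q -> 2 * N <= k + q + 4 -> tleaf T0 u1 ->
  emb (T0 :\ u1) f -> y \in spots u1 f ->
  [\/ #|y |: zone u1 f (U :\ u1)| < #|T0| + #|twigs (U :\ u1)|,
      #|(y |: nbrs y) :|: zone u1 f (U :\ u1)| < N |
      exists2 j, j \in U :\ u1 &
        #|(y |: nbrs y) :|: zone u1 f (U :\ u1 :\ j)| < #|T0| + #|twigs (U :\ j)|].
Proof.
move=> q2 leN lu1 ef ys; have [I IK H] := stuck_spot lu1 ef ys.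
have cK := cardK lu1; have iK := subset_leq_card IK.
have IU := subset_trans IK (subsetDl _ _).
case: H => [[I0 small big]|[small big]].
  have tw := twigs_loss IU.
  have eI : I = U :\ u1 by apply/eqP; rewrite eqEcard IK; lia.
  by apply: Or31; rewrite -eI.
have u1I : u1 \notin I.
  by apply/negP=> /(subsetP IK); rewrite in_setD1 eqxx.
have u1IU : u1 |: I \subset U by rewrite subUset sub1set (u1U lu1).
have tw := twigs_loss u1IU; have cI := cardsU1 u1 I; rewrite u1I in cI.
have [eI|neI] := eqVneq I (U :\ u1).
  by apply: Or32; rewrite eI (setD1K (u1U lu1)) in small.
have prop : I \proper U :\ u1 by rewrite properEneq neI.
have [_ [j jK jI]] := properP prop.
apply: Or33; exists j => //.
have eI : I = U :\ u1 :\ j.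
  apply/eqP; rewrite eqEcard subsetD1 IK jI; have := cardsD1 j (U :\ u1).
  by rewrite jK; arith.
have -> : U :\ j = u1 |: I.
  by rewrite eI setU1D1D1 // ?u1U //; case/setD1P: jK.
by rewrite -eI.
Qed.

Section ManyBearers.
Hypothesis q3 : 3 <= q.
Hypothesis leN : 2 * N <= k + q + 4.
Variable u1 : T.
Hypothesis lu1 : tleaf T0 u1.
Notation X1 := (T0 :\ u1).
Notation K := (U :\ u1).

Let cK := cardK lu1.
Let cX := cardX1 lu1.
Let rX := rX1 lu1.

Lemma cardU_twigs : q <= #|twigs U|.
Proof. by have := twigs_loss (sub0set U); rewrite cards0; lia. Qed.
Let bU := cardU_twigs.

Lemma twigsD1 j : j \in U -> #|twigs (U :\ j)|.+1 <= #|twigs U|.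
Proof. by move=> jU; have := twigs_loss (subsetDl U [set j]); have := cardsD1 j U; rewrite jU; lia. Qed.

Lemma two_spots f : emb X1 f -> 2 <= #|spots u1 f|.
Proof. by move=> ef; have := card_spots lu1 ef; have := min_deg (f (par u1)); lia. Qed.

(** A zone of [N - 1] vertices is too large for a violating set that misses [u1]. For the other two
    kinds the relevant zone already has the greatest size allowed, so [y] and its neighbours add
    nothing to it. *)
Lemma spot_zone f y : emb X1 f -> N <= #|zone u1 f K|.+1 -> y \in spots u1 f ->
  y |: nbrs y \subset zone u1 f K /\
  (#|zone u1 f K|.+1 = N \/ exists2 j, j \in K &
     #|zone u1 f (K :\ j)|.+2 = N /\ y |: nbrs y \subset zone u1 f (K :\ j)).
Proof.
move=> ef big ys; case: (spot_types _ leN lu1 ef ys); first by lia.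
- have := twigsD1 (u1U lu1); have := subset_leq_card (subsetUr [set y] (zone u1 f K)); lia.
- move=> small.
  have eZ : zone u1 f K = (y |: nbrs y) :|: zone u1 f K.
    by apply/eqP; rewrite eqEcard subsetUr; lia.
  split; first by rewrite eZ subsetUl.
  by left; have := subset_leq_card (subsetUr (y |: nbrs y) (zone u1 f K)); lia.
- case=> j jK small; have jU : j \in U by case/setD1P: jK.
  have tw := twigsD1 jU; have := cardsD1 j K; rewrite jK => cj.
  have large : k + #|K :\ j| < 2 * #|zone u1 f (K :\ j)|.
    by apply: zone_large => //; [exact: subsetDl | rewrite -card_gt0; lia].
  have le := subset_leq_card (subsetUr (y |: nbrs y) (zone u1 f (K :\ j))).
  have eZ : zone u1 f (K :\ j) = (y |: nbrs y) :|: zone u1 f (K :\ j).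
    by apply/eqP; rewrite eqEcard subsetUr; lia.
  have sub : y |: nbrs y \subset zone u1 f (K :\ j) by rewrite eZ subsetUl.
  split; first by apply: subset_trans sub (zone_sub _ _ (subsetDl _ _)).
  by right; exists j => //; split=> //; lia.
Qed.

(** With the images of [K :\ j], two such spots would be [q] closed vertices in [N - 2], where fewer
    than [2 * (N - 2) - k <= q] are possible. *)
Lemma spots_pair f j y y' : emb X1 f -> j \in K -> #|zone u1 f (K :\ j)|.+2 = N ->
  y \in spots u1 f -> y |: nbrs y \subset zone u1 f (K :\ j) ->
  y' \in spots u1 f -> y' |: nbrs y' \subset zone u1 f (K :\ j) -> y = y'.
Proof.
move=> ef jK cz ys Ny ys' Ny'; apply/eqP/negPn/negP=> neq.
have := cardsD1 j K; rewrite jK => cj.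
have := zone_capacity (S := [set y; y']) ef (subsetDl K [set j]).
rewrite cards2 neq.
have -> : [set y; y'] \subset zone u1 f (K :\ j).
  by rewrite subUset !sub1set (subsetP Ny) ?(subsetP Ny') // in_setU1 eqxx.
have -> : nbhd [set y; y'] \subset zone u1 f (K :\ j).
  by rewrite nbhd1U /nbhd big_set1 subUset (subset_trans _ Ny) ?(subset_trans _ Ny') ?subsetUr.
have -> : [disjoint [set y; y'] & f @: (K :\ j)].
  apply: disjointWl (spots_disjoint ef _); last first.
    by apply: subset_trans (subsetDl _ _) (subKX1 _).
  by rewrite subUset !sub1set ys.
have -> : [set y; y'] != set0 by apply/set0Pn; exists y; rewrite in_set2 eqxx.
by move=> /(_ isT isT isT isT); lia.
Qed.

(** A zone of [N - 1] vertices has room for two closed spots beside the images of [K]. In a larger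
    zone each spot determines its own bearer [j] in [K]. *)
Lemma spots_le2 f : emb X1 f -> N <= #|zone u1 f K|.+1 ->
  #|spots u1 f| <= 2 /\ (#|zone u1 f K|.+1 = N \/ N <= #|zone u1 f K| /\ q = 3).
Proof.
move=> ef big; have full y := spot_zone (y := y) ef big; have s2 := two_spots ef.
have [eN|neN] := eqVneq #|zone u1 f K|.+1 N.
  split; last by left.
  have S0 : spots u1 f != set0 by rewrite -card_gt0; lia.
  have := zone_capacity ef (subxx _) (S := spots u1 f) _ _ _ S0.
  have -> : spots u1 f \subset zone u1 f K.
    by apply/subsetP=> z /full[/subsetP sZ _]; apply: sZ; rewrite !inE eqxx.
  have -> : nbhd (spots u1 f) \subset zone u1 f K.
    by apply/bigcupsP=> z /full[+ _]; rewrite subUset => /andP[].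
  by move=> /(_ isT isT (spots_disjoint ef (subKX1 u1))); lia.
pose sp y j := [&& j \in K, #|zone u1 f (K :\ j)|.+2 == N & y |: nbrs y \subset zone u1 f (K :\ j)].
have spP y : y \in spots u1 f -> exists j, sp y j.
  by case/full=> _ [/eqP|[j jK [/eqP cz sub]]]; [rewrite (negbTE neN) | exists j; apply/and3P].
pose J y := odflt u1 [pick j | sp y j].
have JP y : y \in spots u1 f -> sp y (J y).
  by rewrite /J => /spP[j sj]; case: pickP => [//|/(_ j)]; rewrite sj.
have Jinj : {in spots u1 f &, injective J}.
  move=> y y' ys ys' eJ; have /and3P[jK /eqP cz sub] := JP y ys.
  have /and3P[_ _ sub'] := JP y' ys'; rewrite -eJ in sub'.
  exact: (spots_pair ef jK cz ys sub ys' sub').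
have cJ : #|spots u1 f| <= #|K|.
  rewrite -(card_in_imset Jinj); apply: subset_leq_card.
  by apply/subsetP=> _ /imsetP[y /JP/and3P[jK _ _] ->].
(* Two zones of [N - 2] vertices whose union has at least [N] meet in at most [N - 4], too few to
   contain the zone of the bearers left after removing both. For [q = 3] no bearer is left and this
   argument says nothing. *)
have q3' : q = 3.
  apply/eqP; rewrite eqn_leq q3 andbT leqNgt; apply/negP=> q4.
  have [y [y' [ys ys' neq]]] : exists y y', [/\ y \in spots u1 f, y' \in spots u1 f & y != y'].
    by have /card_gt1P[y [y' [ys ys' neq]]] := s2; exists y, y'.
  have /and3P[jK /eqP cz _] := JP y ys; have /and3P[jK' /eqP cz' _] := JP y' ys'.
  set j := J y in jK cz; set j' := J y' in jK' cz'.
  have neJ : j != j' by apply: contra neq => /eqP /Jinj ->.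
  have large : k + #|K :\ j :\ j'| < 2 * #|zone u1 f (K :\ j :\ j')|.
    apply: zone_large => //; first by apply: subset_trans (subsetDl _ _) (subsetDl _ _).
    rewrite -card_gt0; have := cardsD1 j K; have := cardsD1 j' (K :\ j).
    by rewrite jK in_setD1 eq_sym neJ jK'; lia.
  have subI : zone u1 f (K :\ j :\ j') \subset zone u1 f (K :\ j) :&: zone u1 f (K :\ j').
    by rewrite subsetI !zone_sub //; [rewrite setDDl setUC -setDDl|]; apply: subsetDl.
  have subU : zone u1 f K \subset zone u1 f (K :\ j) :|: zone u1 f (K :\ j').
    rewrite subUset subsetU ?subsetUl //=; apply/subsetP=> w /nbhdP[_ /imsetP[t tK ->] tw].
    have [etj|ntj] := eqVneq t j.
      apply/setUP; right; apply/setUP; right; apply/nbhdP; exists (f t) => //.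
      by rewrite imset_f // in_setD1 etj neJ -etj.
    apply/setUP; left; apply/setUP; right; apply/nbhdP; exists (f t) => //.
    by rewrite imset_f // in_setD1 ntj.
  have := subset_leq_card subI; have := subset_leq_card subU.
  have := cardsUI (zone u1 f (K :\ j)) (zone u1 f (K :\ j')).
  have := cardsD1 j K; have := cardsD1 j' (K :\ j).
  rewrite jK in_setD1 eq_sym neJ jK'; lia.
by split; [lia | right; split=> //; lia].
Qed.

Lemma imset_notin f X t (I : {set T}) :
  emb X f -> I \subset X -> t \in X -> t \notin I -> f t \notin f @: I.
Proof.
move=> [_ finj _] /subsetP IX tX tI; apply/imsetP=> [[s sI /finj eq]].
by move: tI; rewrite eq ?sI // IX.
Qed.

Lemma nbrs_last f : nbrs (f (par u1)) \subset (f @: X1 :\ f (par u1)) :|: spots u1 f.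
Proof.
apply/subsetP=> y Ny; have yR : y != f (par u1).
  by apply: contraTneq Ny => ->; apply: notin_nbrs.
by rewrite in_setU in_setD1 in_setD Ny yR andbT orbN.
Qed.

(** All neighbours of the parent's image are in the core image or are spots, hence in the zone. If
    the parent is not in [K], its image is a closed vertex beyond the two spots, and there is no
    room for it. *)
Lemma last_parent_bearer f : emb X1 f -> #|zone u1 f K|.+1 = N -> par u1 \in K.
Proof.
move=> ef cz; apply/negPn/negP=> rK.
have big : N <= #|zone u1 f K|.+1 by rewrite cz.
have full y := spot_zone (y := y) ef big; have s2 := two_spots ef.
have prX := par_u1 lu1.
have sub : spots u1 f \subset zone u1 f K.
  by apply/subsetP=> z /full[/subsetP sZ _]; apply: sZ; rewrite !inE eqxx.
have RS : f (par u1) \notin spots u1 f by rewrite in_setD imset_f.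
have S0 : f (par u1) |: spots u1 f != set0 by apply/set0Pn; exists (f (par u1)); rewrite setU11.
have := zone_capacity ef (subxx _) (S := f (par u1) |: spots u1 f) _ _ _ S0.
rewrite cardsU1 RS subUset sub1set sub in_setU imset_f //=.
have -> : nbhd (f (par u1) |: spots u1 f) \subset zone u1 f K.
  rewrite nbhd1U subUset; apply/andP; split.
    apply: subset_trans (nbrs_last f) _; rewrite subUset sub andbT.
    by apply: subset_trans (subsetDl _ _) (subsetUl _ _).
  by apply/bigcupsP=> z /full[+ _]; rewrite subUset => /andP[].
have -> : [disjoint f (par u1) |: spots u1 f & f @: K].
  rewrite -setI_eq0 setIUl setU_eq0 !setI_eq0 disjoints1 (spots_disjoint ef (subKX1 u1)) andbT.
  exact: imset_notin ef (subKX1 u1) _ _.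
by move=> /(_ isT isT isT); arith.
Qed.

(** In a smaller zone the images of [K] are all the closed vertices that local density admits, so
    every other vertex has a neighbour outside. Such a leak rules out all violating sets, or else
    offers a bearer a new place that enlarges the zone. *)
Lemma zone_grows : exists2 f, emb X1 f & N <= #|zone u1 f K|.+1.
Proof.
have [f ef] : exists f, emb X1 f by apply: emb_start => //; arith.
have K0 : K != set0 by rewrite -card_gt0; arith.
have large := zone_large ef (subxx _) K0.
have [big|small] := leqP N #|zone u1 f K|.+1; first by exists f.
have prX := par_u1 lu1.
have NK : nbhd (f @: K) \subset zone u1 f K by apply: subsetUr.
have leaky z : z \in zone u1 f K -> z \notin f @: K -> ~~ (nbrs z \subset zone u1 f K).
  move=> zZ zK; apply/negP=> Nz.
  have := zone_capacity ef (subxx _) (S := [set z]).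
  rewrite sub1set zZ /nbhd big_set1 Nz disjoints1 zK -card_gt0 cards1.
  by move=> /(_ isT isT isT isT); arith.
have [rK|rK] := boolP (par u1 \in K); last first.
  have := leaky (f (par u1)); rewrite in_setU imset_f //.
  rewrite (imset_notin ef (subKX1 u1)) // => /(_ isT isT) /subsetPn[y Ny yZ].
  have ys : y \in spots u1 f.
    by rewrite in_setD Ny andbT; apply: contra yZ => yf; rewrite in_setU yf.
  have cy : #|y |: zone u1 f K| = #|zone u1 f K|.+1 by rewrite cardsU1 yZ.
  case: (spot_types _ leN lu1 ef ys); first by arith.
  - by have := twigsD1 (u1U lu1); arith.
  - move=> le.
    have sub : y |: zone u1 f K \subset (y |: nbrs y) :|: zone u1 f K.
      by rewrite setUSS // subsetUl.
    have eZ : y |: zone u1 f K = (y |: nbrs y) :|: zone u1 f K.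
      by apply/eqP; rewrite eqEcard sub; arith.
    (* As [y] lies outside the zone, it is joined to no image of [K]; this pushes its degree below
       [k / 2]. *)
    have Ny' : nbrs y \subset zone u1 f K :\: f @: K.
      apply/subsetP=> w wy; rewrite in_setD; apply/andP; split.
        apply: contra yZ => wK; apply: (subsetP NK); apply/nbhdP; exists w => //.
        by move: wy; rewrite inE adj_sym.
      have : w \in y |: zone u1 f K by rewrite eZ !in_setU wy orbT.
      rewrite in_setU1 => /orP[/eqP ew|//].
      by move: wy; rewrite ew (negbTE (notin_nbrs y)).
    have := subset_leq_card Ny'; have := min_deg y; rewrite cardsDS; last first.
      by apply: subset_trans (imsetS _ (subKX1 _)) (subsetUl _ _).
    by rewrite (card_embX1 ef (subKX1 _)); arith.
  - case=> j jK; have := twigsD1 (subsetP (subsetDl _ _) _ jK).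
    have lej : k + #|K :\ j| < 2 * #|zone u1 f (K :\ j)|.
      apply: zone_large => //; [exact: subsetDl | rewrite -card_gt0].
      by have := cardsD1 j K; rewrite jK; arith.
    have := cardsD1 j K; rewrite jK => cj.
    have eZ : zone u1 f (K :\ j) = zone u1 f K.
      by apply/eqP; rewrite eqEcard zone_sub ?subsetDl //; arith.
    rewrite eZ => tw le.
    have sub : y |: zone u1 f K \subset (y |: nbrs y) :|: zone u1 f K.
      by rewrite setUSS // subsetUl.
    by have := subset_leq_card sub; arith.
have [ru1 rU] := setD1P rK; have /andP[rT rv] := bearers_T0 rU.
have [u lu] : exists u, tleaf X1 u by apply: (rooted_leaf par_root dep_par prX).
have [uX uv chu] := lu.
have uK : u \in K.
  have [uu1 uT] := setD1P uX.
  have [->//|ur] := eqVneq u (par u1).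
  rewrite in_setD1 uu1; apply: bearP; split=> // w wT.
  by have [->|wu1] := eqVneq w u1; [rewrite eq_sym | apply: chu; rewrite in_setD1 wu1].
have puX : par u \in X1 :\ u by rewrite in_setD1 (par_neq dep_par) // (proj2 rX).
have cX1 := cardsD1 u X1; rewrite uX in cX1.
have efu : emb (X1 :\ u) f by apply: emb_sub ef; apply: subsetDl.
have cK1 := cardsD1 u K; rewrite uK in cK1.
have sK : K :\ u \subset X1 :\ u by apply/setSD/subKX1.
(* The neighbourhood of the remaining bearers already covers the whole zone. *)
have eZ : f @: (X1 :\ u) :|: nbhd (f @: (K :\ u)) = zone u1 f K.
  apply/eqP; rewrite eqEcard setUSS ?imsetS ?subsetDl //=; last first.
    by apply/nbhdS/imsetS; apply: subsetDl.
  have := zone_bound (I := K :\ u) (Z := f @: (X1 :\ u) :|: nbhd (f @: (K :\ u))) ef.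
  rewrite (subset_trans sK) ?subsetDl // subsetUr subsetU ?imsetS //.
  have -> : K :\ u != set0.
    by rewrite -card_gt0; arith.
  by move=> /(_ isT isT isT isT); arith.
(* The new place of [u]. If the image of [par u] is closed, any free neighbour of it leaks;
   otherwise that image has a neighbour outside the zone. *)
have [c [Nc cf cZ]] : exists c, [/\ c \in nbrs (f (par u)), c \notin f @: (X1 :\ u) &
    ~~ ((c |: nbrs c) \subset zone u1 f K)].
  have [pK|pK] := boolP (f (par u) \in f @: K).
    have : 0 < #|nbrs (f (par u)) :\: f @: X1|.
      rewrite cardsD.
      have : nbrs (f (par u)) :&: f @: X1 \subset f @: X1 :\ f (par u).
        apply/subsetP=> y; rewrite !inE => /andP[py ->]; rewrite andbT.
        by apply/eqP=> eq; rewrite eq adj_irrefl in py.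
      move/subset_leq_card; have := cardsD1 (f (par u)) (f @: X1).
      rewrite imset_f ?(subsetP (subsetDl _ _) _ puX) // (card_embX1 ef) //.
      by have := min_deg (f (par u)); arith.
    case/card_gt0P=> c /setDP[Nc cf]; exists c; split=> //.
      by apply: contra cf; apply/subsetP/imsetS/subsetDl.
    apply: contra (leaky c _ _); first by rewrite subUset => /andP[].
      by apply: (subsetP NK); apply: (subsetP (nbrs_sub_nbhd pK)).
    by apply: contra cf; apply/subsetP/imsetS/subKX1.
  have := leaky (f (par u)); rewrite pK in_setU imset_f ?(subsetP (subsetDl _ _) _ puX) //.
  move=> /(_ isT isT) /subsetPn[c Nc cZ]; exists c; split=> //.
    by apply: contra cZ => cf; rewrite -eZ in_setU cf.
  by apply: contra cZ; rewrite subUset sub1set => /andP[].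
exists (upd f u c).
  by apply: (emb_upd_leaf dep_par) => //; rewrite inE in Nc.
have sub : zone u1 f K \subset zone u1 (upd f u c) K.
  rewrite -eZ /zone !imset_upd // nbhd1U; apply: setUSS; first exact: subsetUr.
  exact: subsetUr.
have sub' : (c |: nbrs c) :|: zone u1 f K \subset zone u1 (upd f u c) K.
  rewrite subUset sub andbT subUset sub1set /zone !imset_upd // nbhd1U.
  by rewrite !in_setU set11 /= subsetU // subsetUl orbT.
have := subset_leq_card sub'; suff : #|zone u1 f K| < #|(c |: nbrs c) :|: zone u1 f K| by arith.
apply: proper_card; rewrite properE subsetUr subUset negb_and cZ //.
Qed.

Lemma card_nbrs_in1 (Z : {set G}) u w : u \in Z -> nbrs u \subset Z -> w \in Z -> w != u ->
  w \notin nbrs u -> #|nbrs u| + 2 <= #|Z|.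
Proof.
move=> uZ NZ wZ wu Nw; have : nbrs u \subset Z :\ u :\ w.
  by rewrite !subsetD1 NZ Nw notin_nbrs.
move/subset_leq_card; have := cardsD1 w (Z :\ u); have := cardsD1 u Z.
by rewrite in_setD1 wu uZ wZ; arith.
Qed.

Lemma card_nbrs_out1 (S Z : {set G}) u w : S \subset Z -> nbrs u \subset Z -> w \in Z ->
  w \notin S -> w \notin nbrs u -> #|nbrs u :\: S| + #|S| < #|Z|.
Proof.
move=> SZ NZ wZ wS Nw; have : nbrs u :\: S \subset (Z :\: S) :\ w.
  by rewrite subsetD1 setSD // in_setD (negbTE Nw) andbF.
move/subset_leq_card; have := cardsD1 w (Z :\: S); have := cardsUD S Z.
by rewrite (setUidPr SZ) in_setD wS wZ; arith.
Qed.

(* The image of the parent of [u1] misses so much of the zone that local density leaves no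
   room for another missing edge. *)
Lemma universal_spot f c w : emb X1 f -> #|zone u1 f K|.+1 = N ->
  c \in spots u1 f -> w \in zone u1 f K -> w != c -> adj c w.
Proof.
move=> ef cz cs wZ wc; apply/negPn/negP=> cw.
have big : N <= #|zone u1 f K|.+1 by rewrite cz.
have rK := last_parent_bearer ef cz; have [le2 _] := spots_le2 ef big.
have full y := spot_zone (y := y) ef big; have s2 := two_spots ef.
set Z := zone u1 f K in cz wZ big full; set C := spots u1 f in cs le2 s2 full.
have prX := par_u1 lu1; set R := f (par u1).
(* These are [q + 1] closed vertices, each contributing at most [2 * N - q - 4 <= k] to the edge
   count, and local density tolerates a total defect of [q]. [R], with at most two neighbours
   outside the image, is short by [2 * q - 4] or more, and the missing edge costs 2 more: too much
   for [q >= 3]. *)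
pose B := f @: K :|: C.
have CZ : C \subset Z.
  by apply/subsetP=> z /full[/subsetP sZ _]; apply: sZ; rewrite !inE eqxx.
have KZ : f @: K \subset Z by apply: subset_trans (imsetS _ (subKX1 _)) (subsetUl _ _).
have BZ : B \subset Z by rewrite subUset KZ.
have dis := spots_disjoint ef (subKX1 u1).
have cB : #|B| = q + 1.
  by rewrite cardsU setIC disjoint_setI0 // cards0 (card_embX1 ef (subKX1 _)); arith.
have NB u : u \in B -> nbrs u \subset Z.
  case/setUP=> [uK|/full[+ _]]; last by rewrite subUset => /andP[].
  by apply: subset_trans (nbrs_sub_nbhd uK) (subsetUr _ _).
have RK : R \in f @: K by apply: imset_f.
have RB : R \in B by rewrite in_setU RK.
have cB' : c \in B by rewrite in_setU cs orbT.
have Rc : c \in nbrs R by case/setDP: cs.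
have cR : c != R by apply: contraTneq Rc => ->; apply: notin_nbrs.
have cXf : #|f @: X1| = #|X1| by apply: (card_embX1 ef).
have gR : #|nbrs R| + #|nbrs R :\: B| + q <= 2 * #|T0|.
  have := nbrs_last f; rewrite -/R -/C => NR.
  have : nbrs R :\: B \subset f @: X1 :\: f @: K.
    apply/subsetP=> y /setDP[/(subsetP NR)]; rewrite !in_setU negb_or in_setD1 in_setD.
    by case/orP=> [/andP[_ ->] /andP[-> _]|->] //; rewrite andbF.
  move/subset_leq_card; rewrite [X in _ <= X]cardsDS; last exact: imsetS _ (subKX1 _).
  rewrite cXf (card_embX1 ef (subKX1 _)).
  have := subset_leq_card NR; rewrite cardsU; have := cardsD1 R (f @: X1).
  by rewrite imset_f // cXf; have := subset_leq_card (subKX1 u1); arith.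
have gB u : u \in B -> #|nbrs u| + #|nbrs u :\: B| + q + 4 <= 2 * N.
  move=> uB; have := card_nbrs_in (subsetP BZ _ uB) (NB u uB).
  have := card_nbrs_out BZ (NB u uB); have := subset_leq_card BZ; rewrite cB.
  by arith.
have wNc : w \notin nbrs c by rewrite inE.
have := denseG (S := B); rewrite -card_gt0 cB addn1 => /(_ isT).
rewrite (big_setD1 R) //= (big_setD1 c) /=; last by rewrite in_setD1 cR.
have cB1 := cardsD1 R B; rewrite RB in cB1.
have cB2 := cardsD1 c (B :\ R); rewrite in_setD1 cR cB' in cB2.
have [wB|wB] := boolP (w \in B); last first.
  have g1 := card_nbrs_in1 (subsetP BZ _ cB') (NB c cB') wZ wc wNc.
  have g2 := card_nbrs_out1 BZ (NB c cB') wZ wB wNc.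
  have : \sum_(u in B :\ R :\ c) (#|nbrs u| + #|nbrs u :\: B|) <=
         \sum_(u in B :\ R :\ c) (2 * N - q - 4).
    by apply: leq_sum => u /setD1P[_ /setD1P[_ /gB]]; arith.
  rewrite sum_nat_const; set s := #|B :\ R :\ c| in cB2 *.
  clear -gR g1 g2 cz leN cB cB1 cB2 bU q3; nia.
have wR : w != R by apply: contraNneq wNc => ->; move: Rc; rewrite !inE adj_sym.
have cNw : c \notin nbrs w by move: wNc; rewrite !inE adj_sym.
rewrite (big_setD1 w) /=; last by rewrite !in_setD1 wR wc.
have cB3 := cardsD1 w (B :\ R :\ c); rewrite !in_setD1 wc wR wB in cB3.
have g1 := card_nbrs_in1 (subsetP BZ _ cB') (NB c cB') wZ wc wNc.
have g2 : #|nbrs w| + 2 <= #|Z|.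
  by apply: card_nbrs_in1 (NB w wB) (subsetP CZ _ cs) _ cNw; rewrite // eq_sym.
have g3 := card_nbrs_out BZ (NB c cB'); have g4 := card_nbrs_out BZ (NB w wB).
have : \sum_(u in B :\ R :\ c :\ w) (#|nbrs u| + #|nbrs u :\: B|) <=
       \sum_(u in B :\ R :\ c :\ w) (2 * N - q - 4).
  by apply: leq_sum => u /setD1P[_ /setD1P[_ /setD1P[_ /gB]]]; arith.
rewrite sum_nat_const; set s := #|B :\ R :\ c :\ w| in cB3 *.
clear -gR g1 g2 g3 g4 cz leN cB cB1 cB2 cB3 bU q3; nia.
Qed.

(** A spot [c] joined to the whole zone can replace the image of [par u1]. Since [c] has at least
    [N - 2] neighbours, at least [q] spots result, yet there can be only two. *)
Lemma zone_not_tight f : emb X1 f -> #|zone u1 f K|.+1 = N -> False.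
Proof.
move=> ef cz; have s2 := two_spots ef.
have [c cs] : exists c, c \in spots u1 f by apply/card_gt0P; lia.
have uni w := universal_spot (w := w) ef cz cs.
have rK := last_parent_bearer ef cz; have [_ rU] := setD1P rK.
have /andP[_ rv] := bearers_T0 rU; have prX := par_u1 lu1.
have cf : c \notin f @: X1 by case/setDP: cs.
have efr : emb (X1 :\ par u1) f by apply: emb_sub ef; apply: subsetDl.
have efc : emb X1 (upd f (par u1) c).
  apply: (emb_upd_full dep_par efr) => // t tX _; apply: uni.
    by rewrite in_setU imset_f.
  by apply: contraNneq cf => <-; apply: imset_f.
have Zc : zone u1 f K \subset c |: nbrs c.
  apply/subsetP=> w wZ; rewrite in_setU1 inE; case: eqVneq => //= wc; exact: uni.
have sub : c |: nbrs c \subset zone u1 (upd f (par u1) c) K.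
  by rewrite /zone !imset_upd // nbhd1U setUSS ?subsetUl.
have big : N <= #|zone u1 (upd f (par u1) c) K|.+1.
  by have := subset_leq_card (subset_trans Zc sub); lia.
have [le2 _] := spots_le2 efc big; move: le2.
have := subset_leq_card Zc; rewrite cardsU1 notin_nbrs /=.
have := card_spots lu1 efc; rewrite updE; arith.
Qed.

(** All sizes are forced: [K] consists of [j] and [j'], the closed neighbourhoods of their images
    are the two small zones, and these meet exactly in the core image. Exchanging [j] with [par u1]
    then creates a spot that the new zone does not contain. *)
Lemma zone_not_large f : emb X1 f -> N <= #|zone u1 f K| -> False.
Proof.
move=> ef big; have big1 := leqW big; have [le2 H] := spots_le2 ef big1.
have q3' : q = 3 by case: H => [|[]] //; lia.
have full y := spot_zone (y := y) ef big1; have s2 := two_spots ef.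
have sp y : y \in spots u1 f -> exists2 j, j \in K &
    #|zone u1 f (K :\ j)|.+2 = N /\ y |: nbrs y \subset zone u1 f (K :\ j).
  by case/full=> _ [|//]; lia.
have /card_gt1P[y [y' [ys ys' neq]]] := s2.
have [j jK [cz sub]] := sp _ ys; have [j' jK' [cz' sub']] := sp _ ys'.
have neJ : j != j'.
  apply: contra neq => /eqP eJ; rewrite -eJ in sub'.
  by rewrite (spots_pair ef jK cz ys sub ys' sub').
have c1 := cardsD1 j K; have c2 := cardsD1 j' (K :\ j).
rewrite jK in_setD1 eq_sym neJ jK' /= in c1 c2.
have eK : K :\ j = [set j'].
  apply/eqP; rewrite eq_sym eqEcard sub1set in_setD1 eq_sym neJ jK' cards1; arith.
have eK' : K :\ j' = [set j].
  have c3 := cardsD1 j' K; rewrite jK' in c3.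
  by apply/eqP; rewrite eq_sym eqEcard sub1set in_setD1 neJ jK cards1; arith.
have cS := card_spots lu1 ef; have dR := min_deg (f (par u1)).
have jX := subsetP (subKX1 u1) _ jK; have jX' := subsetP (subKX1 u1) _ jK'.
have [ju1 jU] := setD1P jK; have [ju1' jU'] := setD1P jK'.
have /andP[_ jv] := bearers_T0 jU; have /andP[_ jv'] := bearers_T0 jU'.
have cXf : #|f @: X1| = #|X1| by apply: (card_embX1 ef).
have n4 : 4 <= #|T0|.
  have : v |: U \subset T0.
    by rewrite subUset sub1set (proj1 rT0); apply: sub_bearers_T0.
  by move/subset_leq_card; rewrite cardsU1 in_setD1 eqxx /=; arith.
set Z := zone u1 f (K :\ j) in cz sub; set Z' := zone u1 f (K :\ j') in cz' sub'.
have dj (u : G) (S : {set G}) : k <= 2 * #|nbrs u| -> #|S|.+2 = N -> u |: nbrs u \subset S -> u |: nbrs u = S.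
  move=> du cS' uS; apply/eqP; rewrite eqEcard uS cardsU1 notin_nbrs; arith.
have eZ' : f j |: nbrs (f j) = Z'.
  apply: dj => //; first exact: min_deg.
  by rewrite /Z' /zone eK' imset_set1 /nbhd big_set1 setSU // sub1set imset_f.
have eZ : f j' |: nbrs (f j') = Z.
  apply: dj => //; first exact: min_deg.
  by rewrite /Z /zone eK imset_set1 /nbhd big_set1 setSU // sub1set imset_f.
have cU : N <= #|Z :|: Z'|.
  apply: leq_trans big (subset_leq_card _).
  apply/subsetP=> w; rewrite {1}/zone -(setD1K jK) eK imsetU1 imset_set1 nbhd1U nbhd1.
  case/setUP=> [wX|/setUP[wj|wj]]; first by rewrite !in_setU wX.
    by rewrite in_setU -eZ' in_setU1 wj !orbT.
  by rewrite in_setU -eZ in_setU1 wj orbT.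
have eI : Z :&: Z' = f @: X1.
  apply/esym/eqP; rewrite eqEcard subsetI !subsetUl cXf; have := cardsUI Z Z'; arith.
have yf : y \notin f @: X1 by case/setDP: ys.
have yf' : y' \notin f @: X1 by case/setDP: ys'.
have yZ : y \in Z by apply: (subsetP sub); apply: setU11.
have yZ' : y' \in Z' by apply: (subsetP sub'); apply: setU11.
have yNZ' : y \notin Z' by apply: contra yf => yZ1; rewrite -eI in_setI yZ.
have yNZ : y' \notin Z by apply: contra yf' => yZ1; rewrite -eI in_setI yZ1.
have eC : spots u1 f = [set y; y'].
  by apply/esym/eqP; rewrite eqEcard subUset !sub1set ys ys' cards2 neq.
have prX := par_u1 lu1; set R := f (par u1).
have NR := nbrs_last f; rewrite -/R eC in NR.
have cN : #|(f @: X1 :\ R) :|: [set y; y']| <= #|X1| + 1.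
  by rewrite cardsU cards2 neq; have := cardsD1 R (f @: X1); rewrite imset_f // cXf; arith.
have eR : nbrs R = (f @: X1 :\ R) :|: [set y; y'].
  by apply/eqP; rewrite eqEcard NR; rewrite -/R in dR cS; arith.
have Runi t : t \in X1 -> t != par u1 -> adj R (f t).
  move=> tX tr; have : f t \in nbrs R.
    rewrite eR in_setU in_setD1 imset_f // andbT; apply/orP; left.
    by apply: contraNneq tr => e; have [_ finj _] := ef; rewrite (finj _ _ tX prX e).
  by rewrite inE.
have RyC : y \in nbrs R /\ y' \in nbrs R by rewrite eR !inE !eqxx !orbT.
have rv : par u1 != v.
  apply/eqP=> rv; have [fv _ _] := ef.
  have := xdeg; have : #|nbrs x| <= #|X1| + 1 by rewrite -fv -rv -/R eR.
  by arith.
have rj : par u1 != j.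
  apply: contraNneq yNZ' => e; rewrite -eZ' -e in_setU; apply/orP; right; exact: (proj1 RyC).
have rj' : par u1 != j'.
  apply: contraNneq yNZ => e; rewrite -eZ -e in_setU; apply/orP; right; exact: (proj2 RyC).
have juni t : t \in X1 -> t != j -> adj (f j) (f t).
  move=> tX tj; have : f t \in f j |: nbrs (f j) by rewrite eZ' in_setU imset_f.
  rewrite in_setU1 inE => /orP[/eqP e|//]; have [_ finj _] := ef.
  by case/eqP: tj; apply: finj.
pose f' := f \o tperm (par u1) j.
have ef' : emb X1 f' by apply: (emb_swap dep_par).
have eX : f' @: X1 = f @: X1.
  apply/eqP; rewrite eqEcard (card_embX1 ef') // cXf leqnn andbT.
  by apply/subsetP=> _ /imsetP[t tX ->]; apply: imset_f; case: tpermP => // ->.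
have fj : f' j = R by rewrite /f' /= tpermR.
have fr : f' (par u1) = f j by rewrite /f' /= tpermL.
have fj' : f' j' = f j' by rewrite /f' /= tpermD // eq_sym.
have eKf : f' @: K = [set R; f j'].
  by rewrite -(setD1K jK) eK imsetU1 imset_set1 fj fj'.
have eZ'' : zone u1 f' K = f @: X1 :|: (nbrs R :|: nbrs (f j')).
  by rewrite /zone eX eKf nbhd1U /nbhd big_set1.
have big' : N <= #|zone u1 f' K|.+1.
  have : y' |: Z \subset zone u1 f' K.
    rewrite eZ'' -eZ subUset sub1set !in_setU (proj2 RyC) orbT /= subUset sub1set.
    by rewrite !in_setU imset_f //= [_ :|: nbrs _]setUC setUCA subsetUl.
  by move/subset_leq_card; rewrite cardsU1 yNZ; arith.
have : exists w, w \in Z' :\: f @: X1 :\ y'.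
  apply/card_gt0P; have := cardsD1 y' (Z' :\: f @: X1).
  rewrite in_setD yf' yZ' cardsDS ?subsetUl // cXf; arith.
case=> w /setD1P[wy' /setDP[wZ' wf]].
have ws : w \in spots u1 f'.
  rewrite in_setD eX wf fr; move: wZ'; rewrite -eZ' in_setU1 => /orP[/eqP e|//].
  by case/negP: wf; rewrite e imset_f.
have [+ _] := spot_zone ef' big' ws; rewrite subUset sub1set eZ'' => /andP[+ _].
case/setUP=> [|/setUP[]]; first by rewrite (negbTE wf).
  rewrite eR in_setU in_setD1 (negbTE wf) andbF in_set2 (negbTE wy') orbF /=.
  by move=> /eqP e; rewrite e (negbTE yNZ') in wZ'.
move=> wN; case/negP: wf; rewrite -eI in_setI wZ' andbT -eZ in_setU1 wN orbT //.
Qed.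

Lemma many_bearers_case : False.
Proof.
have [f ef big] := zone_grows.
have [e|ne] := eqVneq #|zone u1 f K|.+1 N; first exact: zone_not_tight ef e.
by apply: (zone_not_large ef); lia.
Qed.
End ManyBearers.

(** * Two bearers *)

Lemma dep_iter n w : dep (iter n par w) <= dep w.
Proof.
elim: n => //= n IHn; apply: leq_trans IHn.
by have [->|wv] := eqVneq (iter n par w) v; [rewrite par_root | rewrite ltnW ?dep_par].
Qed.

Lemma tleaf_above w : w \in T0 -> w != v -> exists2 l, tleaf T0 l & exists n, iter n par l = w.
Proof.
have [n] := ubnP (\max_(u in T0) dep u - dep w); elim: n w => // n IHn w lew wT wv.
have [/existsP[c /andP[cT /eqP pc]]|/existsPn leafw] := boolP [exists c, (c \in T0) && (par c == w)].
  have cv : c != v by apply: contraNneq wv => cv; rewrite -pc cv par_root.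
  have dc := dep_parS cv; have dmax : dep c <= \max_(u in T0) dep u by apply: (leq_bigmax_cond (F := dep)).
  have [||//|l ll [m em]] := IHn c; first by rewrite pc in dc; arith.
  - by [].
  by exists l => //; exists m.+1; rewrite iterS em.
exists w; last by exists 0.
by split=> // c cT; have := leafw c; rewrite cT.
Qed.

Lemma inj_into (E : {set T}) (A : {set G}) : #|E| <= #|A| ->
  exists g : T -> G, {in E &, injective g} /\ {in E, forall u, g u \in A}.
Proof.
move=> le; apply: (hall_marriage x (F := fun=> A)) => J JE.
have [->|J0] := eqVneq J set0; first by rewrite cards0.
have [j jJ] := set0Pn _ J0.
apply: leq_trans (subset_leq_card JE) (leq_trans le (subset_leq_card _)).
exact: (bigcup_sup j).
Qed.

Section TwoBearers.
Variables (h : nat) (u1 u2 : T).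
Hypothesis lu1 : tleaf T0 u1.
Hypothesis u12 : u1 != u2.
Hypothesis eU : U = [set u1; u2].
Hypothesis kh : k = 2 * h.
Hypothesis Nh : N = h + 3.
Hypothesis root_max : {in U, forall u, #|twigs [set u]| <= #|twigs [set v]|}.
Notation X1 := (T0 :\ u1).
Notation b1 := (#|twigs [set u1]|).
Notation b2 := (#|twigs [set u2]|).

Let cX := cardX1 lu1.
Let rX := rX1 lu1.

Lemma q2 : q = 2. Proof. by rewrite eU cards2 u12. Qed.
Let u1U : u1 \in U. Proof. by rewrite eU !inE eqxx. Qed.
Let u2U : u2 \in U. Proof. by rewrite eU !inE eqxx orbT. Qed.
Let u2T : u2 \in T0. Proof. by case/andP: (bearers_T0 u2U). Qed.
Let u2v : u2 != v. Proof. by case/andP: (bearers_T0 u2U). Qed.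
Let u1T : u1 \in T0. Proof. by case/andP: (bearers_T0 u1U). Qed.
Let u1v : u1 != v. Proof. by case/andP: (bearers_T0 u1U). Qed.
Let u2X : u2 \in X1. Proof. by rewrite in_setD1 eq_sym u12. Qed.
Let vX : v \in X1. Proof. by case: rX. Qed.

Lemma twig_counts : [/\ #|twigs U| = b1 + b2, 0 < b1, 0 < b2, #|twigs [set v]| + 2 = h &
  #|T0| + b1 + b2 = h + 3].
Proof.
have bs : #|twigs U| = b1 + b2.
  have -> : twigs U = twigs [set u1] :|: twigs [set u2].
    by apply/setP=> l; rewrite eU in_setU !in_twigs !inE -andb_orr.
  rewrite cardsU; have -> : twigs [set u1] :&: twigs [set u2] = set0.
    apply/setP=> l; rewrite in_setI !in_twigs !inE; apply/negbTE.
    by apply: contra u12 => /andP[/andP[_ /eqP<-] /andP[_ ]].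
  by rewrite cards0 subn0.
have t1 := twigs_loss (I := [set u1]); have t2 := twigs_loss (I := [set u2]).
rewrite sub1set u1U cards1 q2 in t1; rewrite sub1set u2U cards1 q2 in t2.
have := t1 isT; have := t2 isT; have := card_twigs.
by split; arith.
Qed.

Lemma h_bounds : [/\ b1 + 2 <= h, b2 + 2 <= h & 3 <= h].
Proof. by have [_ ? ? ? _] := twig_counts; have := root_max u1U; have := root_max u2U; split; arith. Qed.

Lemma degh u : h <= #|nbrs (u : G)|.
Proof. by have := min_deg u; arith. Qed.

Lemma closed2 (S Z : {set G}) : S != set0 -> S \subset Z -> nbhd S \subset Z ->
  2 * h + #|S| < 2 * #|Z|.
Proof. by rewrite -kh; apply: closed_bound. Qed.

(** [h = k / 2] is the least degree that local density permits. *)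
Definition low (u : G) := #|nbrs u| == h.

Lemma highP u : ~~ low u -> h < #|nbrs u|.
Proof. by move=> lu; rewrite ltn_neqAle degh eq_sym lu. Qed.

(** Two adjacent vertices of degree [h] meet only [2 * h - 1 = k - 1] edges, and local density asks
    for more. *)
Lemma low_indep u w : adj u w -> low u -> ~~ low w.
Proof.
move=> uw /eqP lu; apply/negP=> /eqP lw.
have neq : u != w by apply: contraTneq uw => ->; rewrite adj_irrefl.
have := denseG (S := [set u; w]); rewrite -card_gt0 cards2 neq.
rewrite big_setU1 ?inE //= big_set1 lu lw => /(_ isT).
have : nbrs u :\: [set u; w] \subset nbrs u :\ w.
  by apply: setDS; rewrite sub1set !inE eqxx orbT.
have : nbrs w :\: [set u; w] \subset nbrs w :\ u.
  by apply: setDS; rewrite sub1set !inE eqxx.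
move=> /subset_leq_card le1 /subset_leq_card le2.
have := cardsD1 w (nbrs u); have := cardsD1 u (nbrs w).
rewrite !inE uw adj_sym uw lu lw kh; arith.
Qed.

Lemma high_zone (Z : {set G}) y : #|Z| <= h + 2 -> y \in Z -> nbrs y \subset Z -> ~~ low y ->
  y |: nbrs y = Z /\ #|Z| = h + 2.
Proof.
move=> cZ yZ NZ /highP hy; have c := cardsU1 y (nbrs y); rewrite notin_nbrs /= in c.
have sub : y |: nbrs y \subset Z by rewrite subUset sub1set yZ.
have le := subset_leq_card sub; split; last by arith.
by apply/eqP; rewrite eqEcard sub; arith.
Qed.

(** Both neighbourhoods fit into the at most [h] remaining vertices of [Z] and have at least [h]
    elements. *)
Lemma nonadj_zone (Z : {set G}) y z : #|Z| <= h + 2 -> y \in Z -> z \in Z -> y != z ->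
  nbrs y \subset Z -> nbrs z \subset Z -> ~~ adj y z ->
  [/\ nbrs y = nbrs z, Z = y |: (z |: nbrs z) & #|nbrs z| = h].
Proof.
move=> cZ yZ zZ yz Ny Nz nadj.
have sy : nbrs y \subset Z :\ y :\ z by rewrite !subsetD1 Ny notin_nbrs /= inE.
have sz : nbrs z \subset Z :\ y :\ z by rewrite !subsetD1 Nz notin_nbrs andbT inE adj_sym.
have c1 := cardsD1 y Z; have c2 := cardsD1 z (Z :\ y).
rewrite yZ in c1; rewrite in_setD1 eq_sym yz zZ in c2.
have dy := degh y; have dz := degh z.
have ey : nbrs y = Z :\ y :\ z by apply/eqP; rewrite eqEcard sy; arith.
have ez : nbrs z = Z :\ y :\ z by apply/eqP; rewrite eqEcard sz; arith.
split; first by rewrite ey.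
- by rewrite ez setD1K ?setD1K // in_setD1 eq_sym yz.
- by have := subset_leq_card sz; arith.
Qed.

(** Hall's condition fails for the two bearers together; [h + 2] is [N - 1]. *)
Definition crowded (f : T -> G) (y : G) :=
  #|f @: X1 :|: (y |: nbrs y) :|: nbrs (f u2)| <= h + 2.

(* The three ways in which the leaves fail to fit when [u1] is placed at [y]. *)
Lemma stuck2 f y : emb X1 f -> y \in spots u1 f ->
  [\/ crowded f y,
      [/\ low y, {in X1, forall t, adj y (f t)} & b2 = 1] |
      [/\ low (f u2), {in X1, forall t, t != u2 -> adj (f u2) (f t)}, adj (f u2) y & b1 = 1]].
Proof.
move=> ef ys; have [bs b1p b2p _ n0] := twig_counts.
have eK : U :\ u1 = [set u2].
  by apply/setP=> t; rewrite eU !inE; case: eqVneq => //= ->; rewrite (negbTE u12).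
have yf : y \notin f @: X1 by case/setDP: ys.
have q2' : 1 < q by rewrite q2.
case: (spot_types q2' _ lu1 ef ys); first by rewrite q2; arith.
- rewrite eK /zone imset_set1 nbhd1 => small; apply: Or33.
  have sub : f u2 |: nbrs (f u2) \subset y |: (f @: X1 :|: nbrs (f u2)).
    by rewrite subUset sub1set !in_setU imset_f //= ?orbT // setUA subsetUr.
  have c := cardsU1 (f u2) (nbrs (f u2)); rewrite notin_nbrs /= in c.
  have d := degh (f u2); have le := subset_leq_card sub.
  have e : f u2 |: nbrs (f u2) = y |: (f @: X1 :|: nbrs (f u2)).
    by apply/eqP; rewrite eqEcard sub; arith.
  have at2 w : w != f u2 -> w \in y |: (f @: X1 :|: nbrs (f u2)) -> adj (f u2) w.
    by rewrite -e in_setU1 inE => /negbTE ->.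
  split.
  + by rewrite /low; apply/eqP; arith.
  + move=> t tX tu; apply: at2; last by rewrite !in_setU imset_f // orbT.
    by have [_ finj _] := ef; apply: contra tu => /eqP /finj ->.
  + by apply: at2; [apply: contraNneq yf => ->; apply: imset_f | rewrite setU11].
  + by arith.
- rewrite eK /zone imset_set1 nbhd1 => small; apply: Or31.
  by rewrite /crowded setUAC [_ :|: (y |: _)]setUC; arith.
- case=> j; rewrite eK inE => /eqP ->.
  have -> : [set u2] :\ u2 = set0 by rewrite setDv.
  have -> : U :\ u2 = [set u1].
    by apply/setP=> t; rewrite eU !inE; case: (eqVneq t u2) => [->|]; rewrite ?orbF // eq_sym (negbTE u12).
  rewrite /zone imset0 /nbhd big_set0 setU0 => small; apply: Or32.
  have sub := subsetUl (y |: nbrs y) (f @: X1).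
  have c := cardsU1 y (nbrs y); rewrite notin_nbrs /= in c.
  have d := degh y; have le := subset_leq_card sub.
  have e : y |: nbrs y = (y |: nbrs y) :|: f @: X1.
    by apply/eqP; rewrite eqEcard sub; arith.
  split; [by rewrite /low; apply/eqP; arith | | by arith].
  move=> t tX; have : f t \in y |: nbrs y by rewrite e in_setU imset_f ?orbT.
  rewrite in_setU1 inE => /orP[/eqP ety|//].
  by case/negP: yf; rewrite -ety imset_f.
Qed.

(** Spots not joined to [f u2] are twins of it. They are the source of the complete bipartite
    obstruction. *)
Lemma crowded_nonadj f y : emb X1 f -> y \in spots u1 f -> ~~ adj (f u2) y ->
  [/\ nbrs y = nbrs (f u2), #|nbrs (f u2)| = h & f @: X1 \subset f u2 |: nbrs (f u2)].
Proof.
move=> ef ys nadj; have yf : y \notin f @: X1 by case/setDP: ys.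
have yu : y != f u2 by apply: contraNneq yf => ->; apply: imset_f.
case: (stuck2 ef ys) => [small|[_ /(_ u2 u2X)]|[_ _ +]]; last first.
- by rewrite (negbTE nadj).
- by rewrite adj_sym (negbTE nadj).
have [|||||e1 e2 e3] := nonadj_zone (z := f u2) small _ _ yu.
- by rewrite !in_setU set11 ?orbT.
- by rewrite !in_setU imset_f.
- by apply: subset_trans (subsetUl _ _); apply: subset_trans (subsetUr _ _); apply: subsetUr.
- exact: subsetUr.
- by rewrite adj_sym.
split=> //.
apply/subsetP=> w wf.
have : w \in y |: (f u2 |: nbrs (f u2)) by rewrite -e2 -setUA in_setU wf.
by rewrite in_setU1 => /orP[/eqP e|//]; rewrite -e wf in yf.
Qed.

Lemma crowded_high f : emb X1 f -> ~~ low (f u2) -> forall y, y \in spots u1 f -> crowded f y ->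
  [/\ adj (f u2) y, f u2 |: nbrs (f u2) = f @: X1 :|: (y |: nbrs y) :|: nbrs (f u2) &
      #|f u2 |: nbrs (f u2)| = h + 2].
Proof.
move=> ef hu y ys small.
have [|||e c] := high_zone (y := f u2) small.
- by rewrite !in_setU imset_f.
- exact: subsetUr.
- exact: hu.
rewrite e c; split=> //; apply/negPn/negP=> nadj.
by have [_ d _] := crowded_nonadj ef ys nadj; rewrite /low d eqxx in hu.
Qed.

(* Either the colour classes of the tree have sizes [h] and [h + 1], or, without the twigs at
   the root, the class of the root has at most [h] vertices and the other one at most [h + 1]. *)
Lemma complete_bipartite_case (A Y : {set G}) : x \in A -> #|A| = h -> h < #|Y| ->
  (forall y, y \in Y -> A \subset nbrs y) -> False.
Proof.
move=> xA cA cY AY; have [_ b1p b2p ca n0] := twig_counts.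
have adjAY a y : a \in A -> y \in Y -> adj a y.
  by move=> aA /AY /subsetP /(_ a aA); rewrite inE adj_sym.
have dis (a y : G) : a \in A -> y \in Y -> a <> y.
  by move=> aA yY e; have := adjAY a y aA yY; rewrite e adj_irrefl.
pose E := [set u | odd (dep u) == odd (dep v)].
have vE : v \in E by rewrite inE.
have colE u : u != v -> (par u \in E) = (u \notin E).
  by move=> uv; rewrite !inE (dep_parS uv) /=; case: odd; case: odd.
have vT : v \in T0 by case: rT0.
have parT u : par u \in T0.
  by have [uT|uT] := boolP (u \in T0); [rewrite (proj2 rT0) | rewrite twigP].
have notT l : l \notin T0 -> l != v by apply: contraNneq => ->.
pose L := twigs [set v].
have LE l : l \in L -> l \notin E.
  by rewrite in_twigs inE => /andP[lT /eqP pl]; rewrite -colE ?pl // notT.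
(* Each bearer supplies a vertex of either colour, itself or one of its leaves. Together with the
   root or the root's leaves these bound one colour class from below, hence the other from above. *)
have pick u c : u \in U -> exists w, [/\ w \notin L, w != v, (w \in E) = c &
    w = u \/ w \notin T0 /\ par w = u].
  move=> uU; have /andP[uT uv] := bearers_T0 uU.
  have [uc|uc] := eqVneq (u \in E) c.
    by exists u; rewrite in_twigs uT; split=> //; left.
  have [l] : exists l, l \in twigs [set u].
    by apply/card_gt0P; move: uU; rewrite eU !inE => /orP[] /eqP ->.
  rewrite in_twigs inE => /andP[lT /eqP pl]; exists l.
  rewrite notT // in_twigs inE pl (negbTE uv) andbF; split=> //; last by right.
  by have := colE l (notT l lT); rewrite pl; move: uc; case: (u \in E); case: (l \in E); case: c.
have bip (X P : {set T}) (g1 g2 : T -> G) : (P = E \/ P = ~: E) ->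
    {in P &, injective g1} -> {in P, forall u, g1 u \in A} ->
    {in X :\: P &, injective g2} -> {in X :\: P, forall u, g2 u \in Y} ->
    let f := fun u => if u \in P then g1 u else g2 u in tree_emb v par (f v) X f.
  move=> PE g1i g1A g2i g2Y f.
  have colP u : u != v -> (par u \in P) = (u \notin P).
    by case: PE => -> uv; rewrite ?in_setC colE.
  split=> //.
    move=> s t sX tX; rewrite /f; case: ifPn => sP; case: ifPn => tP; first exact: g1i.
    - have tY : g2 t \in Y by apply: g2Y; rewrite in_setD tP.
      by move/(dis _ _ (g1A _ sP) tY).
    - have sY : g2 s \in Y by apply: g2Y; rewrite in_setD sP.
      by move/esym/(dis _ _ (g1A _ tP) sY).
    - by apply: g2i; rewrite in_setD ?sP ?tP.
  move=> u uX uv pX; rewrite /f colP //; case: (boolP (u \in P)) => uP /=.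
    rewrite adj_sym; apply: adjAY; [exact: g1A | apply: g2Y].
    by rewrite in_setD pX andbT colP ?negbK.
  by apply: adjAY; [apply: g1A; rewrite colP | apply: g2Y; rewrite in_setD uP].
have [w1 [w1L w1v w1E w1u]] := pick u1 (#|E| <= h) u1U.
have [w2 [w2L w2v w2E w2u]] := pick u2 (#|E| <= h) u2U.
have w12 : w1 != w2.
  case: w1u w2u => [->|[w1T p1]] [->|[w2T p2]] //.
  - by apply: contraNneq w2T => <-.
  - by apply: contraNneq w1T => ->.
  - by apply: contraNneq u12 => e; rewrite -p1 -p2 e.
have cE := cardsC E; rewrite cardT kh in cE.
have [leE|ltE] := leqP #|E| h.
  rewrite leE in w1E.
  have [|g1 [g1i g1A]] := inj_into (E := E :\ v) (A := A :\ x).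
    by have := cardsD1 v E; have := cardsD1 x A; rewrite vE xA; arith.
  pose X := ~: L.
  have [|g2 [g2i g2Y]] := inj_into (E := X :\: E) (A := Y).
    have : X :\: E \subset ~: (E :|: L).
      by apply/subsetP=> u; rewrite !in_setD !in_setC in_setU negb_or.
    move/subset_leq_card; have := cardsC (E :|: L); rewrite cardT kh cardsU.
    have -> : E :&: L = set0.
      by apply/setP=> l; rewrite in_setI in_set0; apply/negbTE/andP=> [[lE /LE]]; rewrite lE.
    rewrite cards0; have := cardsD1 v E; have := cardsD1 w1 (E :\ v).
    rewrite vE in_setD1 w1v w1E /= => e1 e2; rewrite /L; arith.
  have inj1 : {in E &, injective (upd g1 v x)}.
    move=> s t sE tE; rewrite /upd; case: eqVneq => [->|sv]; case: eqVneq => [->|tv] // e.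
    + by have := g1A t; rewrite !in_setD1 tv tE -e eqxx => /(_ isT).
    + by have := g1A s; rewrite !in_setD1 sv sE e eqxx => /(_ isT).
    + by apply: g1i; rewrite // in_setD1 ?sv ?tv.
  have inA : {in E, forall u, upd g1 v x u \in A}.
    move=> u uE; rewrite /upd; case: eqVneq => // uv.
    by have := g1A u; rewrite in_setD1 uv uE => /(_ isT) /setD1P[].
  pose f u := if u \in E then upd g1 v x u else g2 u.
  have ef : tree_emb v par (f v) X f := bip X E _ g2 (or_introl erefl) inj1 inA g2i g2Y.
  have fv : f v = x by rewrite /f vE updE.
  rewrite fv in ef.
  have rXX : rooted v par X.
    by split=> [|u _]; rewrite in_setC in_twigs ?vT ?parT.
  (* Only leaves at the root remain, so there is no bearer to form a violating set. *)
  have [||[g /noT //]|[I [IU I0 _]]] := hall_violator rXX _ ef.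
  - by move=> l; rewrite in_setC negbK => lL; rewrite in_setC in_twigs parT.
  - by rewrite cardT ltnS.
  have [u uI] := set0Pn _ I0; have := subsetP IU u uI.
  rewrite in_setD1 => /andP[uv /imsetP[l]]; rewrite setCK in_twigs inE => /andP[_ /eqP ->] e.
  by rewrite e eqxx in uv.
rewrite leqNgt ltE /= in w1E w2E.
(* Now the root goes into [Y], away from [x]; for this [noT] has to exclude every image of the root.
   The other class contains [w1], [w2] and the [h - 2] leaves at the root. *)
have [|g1 [g1i g1A]] := inj_into (E := ~: E) (A := A); first by arith.
have [|g2 [g2i g2Y]] := inj_into (E := setT :\: ~: E) (A := Y).
  have -> : setT :\: ~: E = E by apply/setP=> u; rewrite in_setD in_setT andbT in_setC negbK.
  have : w1 |: (w2 |: L) \subset ~: E.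
    rewrite !subUset !sub1set !in_setC w1E w2E /=; apply/subsetP=> l /LE.
    by rewrite in_setC.
  move/subset_leq_card; rewrite !cardsU1 in_setU1 (negbTE w12) (negbTE w1L) w2L /= /L.
  arith.
exact: noT (bip setT (~: E) g1 g2 (or_intror erefl) g1i g1A g2i g2Y).
Qed.

(** * Two bearers: [u1] hangs from the root *)

Section RootParent.
Hypothesis ru1 : par u1 = v.

(** Of the at least [2 * h] neighbours of [x], many avoid this small set. They are spots not joined
    to [f u2], hence twins of it, and with [f u2] they form one side of a complete bipartite
    graph. *)
Lemma root_parent_small f : emb X1 f -> #|f @: X1 :|: nbrs (f u2)| <= h + 2 -> False.
Proof.
move=> ef small; have [fv finj _] := ef.
pose Y := nbrs x :\: (f @: X1 :|: nbrs (f u2)).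
have xX : x \in f @: X1 by rewrite -fv imset_f.
have cY : 2 * h < #|Y| + #|f @: X1 :|: nbrs (f u2)|.
  have sub : nbrs x \subset Y :|: ((f @: X1 :|: nbrs (f u2)) :\ x).
    apply/subsetP=> y xy; rewrite in_setU in_setD1 in_setD xy andbT.
    have -> : y != x by apply: contraTneq xy => ->; apply: notin_nbrs.
    by rewrite orNb.
  have := subset_leq_card sub; rewrite cardsU.
  have := cardsD1 x (f @: X1 :|: nbrs (f u2)); rewrite in_setU xX; have := xdeg.
  rewrite kh; arith.
have Ysp y : y \in Y -> y \in spots u1 f /\ ~~ adj (f u2) y.
  case/setDP=> xy; rewrite in_setU negb_or => /andP[yf yN].
  by rewrite in_setD yf /= ru1 fv xy; rewrite inE in yN.
have [y0 y0Y] : exists y, y \in Y by apply/card_gt0P; have [_ _ h3] := h_bounds; arith.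
have [ys0 na0] := Ysp _ y0Y; have [eA cA sA] := crowded_nonadj ef ys0 na0.
have xu : x != f u2.
  by apply/eqP=> e; case/eqP: u2v; apply: finj => //; rewrite fv.
have xA : x \in nbrs (f u2).
  by move: (subsetP sA x xX); rewrite in_setU1 (negbTE xu).
have cZ : #|f @: X1 :|: nbrs (f u2)| <= h + 1.
  have : f @: X1 :|: nbrs (f u2) \subset f u2 |: nbrs (f u2) by rewrite subUset sA subsetUr.
  by move/subset_leq_card; rewrite cardsU1 notin_nbrs cA addnC.
apply: (@complete_bipartite_case (nbrs (f u2)) (f u2 |: Y)) => //.
  have uY : f u2 \notin Y by rewrite in_setD in_setU imset_f.
  by rewrite cardsU1 uY; arith.
move=> y /setU1P[->//|/Ysp[ys na]]; by have [-> _ _] := crowded_nonadj ef ys na.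
Qed.

(** A large set excludes [crowded]. The other failures give a low vertex joined to the rest of the
    image, which is [f u2] or can become it, and this makes the set small. *)
Lemma root_parent_case : False.
Proof.
have [_ b1p b2p _ n0] := twig_counts; have [_ _ h3] := h_bounds.
have [f ef] : exists f, emb X1 f by apply: emb_start => //; rewrite kh; arith.
have [small|large] := leqP #|f @: X1 :|: nbrs (f u2)| (h + 2).
  exact: root_parent_small ef small.
have cS := card_spots lu1 ef; have [fv finj _] := ef.
have [y ys] : exists y, y \in spots u1 f.
  by apply/card_gt0P; rewrite ru1 fv in cS; have := xdeg; rewrite kh; arith.
have yf : y \notin f @: X1 by case/setDP: ys.
case: (stuck2 ef ys) => [crow|[ly uy _]|[/eqP l2 uu _ _]].
- have sub : f @: X1 :|: nbrs (f u2) \subset f @: X1 :|: (y |: nbrs y) :|: nbrs (f u2).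
    by rewrite setSU // subsetUl.
  by have := subset_leq_card sub; move: crow; rewrite /crowded; arith.
- have efu : emb (X1 :\ u2) f by apply: emb_sub ef; apply: subsetDl.
  have ef' : emb X1 (upd f u2 y).
    by apply: (emb_upd_full dep_par efu) => // t tX _; apply: uy.
  apply: (root_parent_small ef'); rewrite updE imset_upd //.
  have sub : y |: f @: (X1 :\ u2) :|: nbrs y \subset y |: nbrs y.
    rewrite !subUset subsetUl subsetUr andbT /=; apply/subsetP=> _ /imsetP[t /setD1P[_ tX] ->].
    by rewrite in_setU1 inE uy ?orbT.
  have := subset_leq_card sub; rewrite cardsU1 notin_nbrs (eqP ly); arith.
- have sub : f @: X1 :|: nbrs (f u2) \subset f u2 |: nbrs (f u2).
    rewrite subUset subsetUr andbT; apply/subsetP=> _ /imsetP[t tX ->].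
    rewrite in_setU1 inE; case: (eqVneq t u2) => [->|tu]; first by rewrite eqxx.
    by rewrite uu ?orbT.
  have := subset_leq_card sub; rewrite cardsU1 notin_nbrs l2; arith.
Qed.
End RootParent.

(* Once a spot [c] leaks out of the zone of [f u2], moving [u2] there frees enough room. *)
Lemma leaky_spot f Z c : emb X1 f -> ~~ low (f u2) -> f u2 |: nbrs (f u2) = Z ->
  #|Z| = h + 2 -> f @: X1 \subset Z -> {in X1, forall t, adj c (f t)} -> low c -> b2 = 1 ->
  adj (upd f u2 c (par u1)) (f u2) -> nbrs c \subset Z.
Proof.
move=> ef hu eZ cZ fZ ac lc b21 adjc; have [_ _ _ _ n0] := twig_counts.
have efu : emb (X1 :\ u2) f by apply: emb_sub ef; apply: subsetDl.
have ef' : emb X1 (upd f u2 c).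
  by apply: (emb_upd_full dep_par efu) => // t tX _; apply: ac.
have us : f u2 \in spots u1 (upd f u2 c).
  rewrite in_setD inE adjc andbT imset_upd // in_setU1 negb_or.
  rewrite (imset_notin ef) ?subsetDl ?setD11 // andbT.
  by apply: contraTneq (ac _ u2X) => ->; rewrite adj_irrefl.
case: (stuck2 ef' us); rewrite ?updE.
- rewrite /crowded eZ updE => small.
  have sub : Z :|: nbrs c \subset upd f u2 c @: X1 :|: Z :|: nbrs c.
    by rewrite setSU // subsetUr.
  have e : Z = Z :|: nbrs c.
    by apply/eqP; rewrite eqEcard subsetUl cZ; have := subset_leq_card sub; arith.
  by rewrite e subsetUr.
- by case=> lu; rewrite lu in hu.
- case=> _ _ _ b11; apply: subset_trans fZ.
  have sub : f @: X1 \subset nbrs c.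
    by apply/subsetP=> _ /imsetP[t tX ->]; rewrite inE ac.
  suff -> : f @: X1 = nbrs c by [].
  apply/eqP; rewrite eqEcard sub (card_embX1 ef) // (eqP lc); arith.
Qed.

Lemma tleaf_pair l : tleaf T0 l -> l = u1 \/ l = u2.
Proof. by move/bearP; rewrite eU in_set2 => /orP[] /eqP ->; [left | right]. Qed.

(** * Two bearers: [u1] hangs from [u2] *)

Section MiddleParent.
Hypothesis ru1 : par u1 = u2.
Notation s := (par u2).

Lemma middle_leaf : tleaf X1 u2.
Proof.
split=> // w /setD1P[wu1 wT]; apply/eqP=> pw.
have wv : w != v by apply: contraNneq u2v => e; rewrite -pw e par_root.
have dw := dep_parS wv; rewrite pw in dw.
have [l ll [n en]] := tleaf_above wT wv.
have : dep w <= dep u2.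
  case: (tleaf_pair ll) en => ->; last by move=> <-; apply: dep_iter.
  case: n => [e|n]; first by rewrite -e eqxx in wu1.
  by rewrite iterSr ru1 => <-; apply: dep_iter.
by rewrite dw ltnn.
Qed.

Lemma middle_root : s = v -> #|T0| = 3.
Proof.
move=> sv; have itv n : iter n par v = v by elim: n => //= n ->.
suff -> : T0 = v |: [set u1; u2].
  by rewrite cardsU1 in_set2 cards2 u12 eq_sym (negbTE u1v) eq_sym (negbTE u2v).
apply/setP=> w; rewrite !inE; apply/idP/idP; last first.
  by case/or3P=> /eqP ->; rewrite ?u1T ?u2T //; case: rT0.
move=> wT; have [//|wv] := eqVneq w v.
have [l ll [n en]] := tleaf_above wT wv; move: wv; rewrite -en.
case: (tleaf_pair ll) => ->.
  case: n {en} => [|[|n]]; rewrite ?eqxx //= -?iterS ?ru1 ?eqxx ?orbT //.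
  by rewrite iterSr iterSr ru1 sv itv eqxx.
case: n {en} => [|n]; first by rewrite eqxx orbT.
by rewrite iterSr sv itv eqxx.
Qed.

Let sX : s \in X1.
Proof.
rewrite in_setD1 (proj2 rT0) // andbT; apply/eqP=> e.
by have := dep_parS u2v; have := dep_parS u1v; rewrite e ru1; arith.
Qed.
Let su2 : s != u2. Proof. exact: par_neq dep_par _ u2v. Qed.

(** [y] and [f u2] have the same closed neighbourhood [Z] of [h + 2] vertices, which has room for
    three closed vertices. These are [f u2] and the [b1 + b2] spots, so [b1 = b2 = 1]. Shifting [u2]
    to the place of its parent would close that vertex too. *)
Lemma middle_high f y : emb X1 f -> y \in spots u1 f -> ~~ low y -> ~~ low (f u2) -> False.
Proof.
move=> ef ys hy hu; have [bs b1p b2p _ n0] := twig_counts; have [_ _ h3] := h_bounds.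
have [_ finj _] := ef.
case: (stuck2 ef ys) => [crow|[ly]|[lu]]; [|by rewrite ly in hy|by rewrite lu in hu].
have [uy eZ cZ] := crowded_high ef hu ys crow.
have [||//|ey _] := high_zone (y := y) crow.
- by rewrite !in_setU set11 ?orbT.
- by apply: subset_trans (subsetUl _ _); apply: subset_trans (subsetUr _ _); apply: subsetUr.
rewrite -eZ in ey; set Z := f u2 |: nbrs (f u2) in eZ cZ ey.
have fZ : f @: X1 \subset Z by rewrite eZ -setUA subsetUl.
have full c : c \in spots u1 f -> nbrs c \subset Z.
  move=> cs; have cu : adj (f u2) c by case/setDP: cs; rewrite ru1 inE.
  case: (stuck2 ef cs) => [/(crowded_high ef hu cs)[_ e _]|[lc ac b21]|[lu]].
  - by rewrite /Z e; apply: subset_trans (subsetUl _ _); apply: subset_trans (subsetUr _ _); apply: subsetUr.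
  - by apply: (leaky_spot ef hu erefl cZ fZ ac lc b21); rewrite ru1 updE adj_sym.
  - by rewrite lu in hu.
have eS : spots u1 f = Z :\: f @: X1.
  apply/setP=> w; rewrite !in_setD ru1 in_setU1.
  by case: (eqVneq w (f u2)) => [->|//]; rewrite imset_f.
have cS : #|spots u1 f| = b1 + b2.
  by rewrite eS cardsDS // cZ (card_embX1 ef) //; arith.
have us : f u2 \notin spots u1 f by rewrite in_setD imset_f.
have cS' : #|f u2 |: spots u1 f| = (b1 + b2).+1 by rewrite cardsU1 us cS.
have capacity w : w \in Z -> w \notin f u2 |: spots u1 f -> ~~ (nbrs w \subset Z).
  move=> wZ wS; apply/negP=> Nw.
  have := closed2 (S := w |: (f u2 |: spots u1 f)) (Z := Z).
  have cW : #|w |: (f u2 |: spots u1 f)| = (b1 + b2).+2 by rewrite cardsU1 wS cS'.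
  rewrite cW cZ -card_gt0 cW !nbhd1U !subUset !sub1set wZ setU11 Nw subsetUr eS subsetDl /=.
  have -> : nbhd (Z :\: f @: X1) \subset Z.
    by rewrite -eS; apply/bigcupsP=> c /full.
  by move=> /(_ isT isT isT); arith.
have bb : b1 + b2 = 2.
  have := closed2 (S := f u2 |: spots u1 f) (Z := Z).
  rewrite cS' cZ -card_gt0 cS' nbhd1U !subUset !sub1set setU11 subsetUr eS subsetDl /=.
  have -> : nbhd (Z :\: f @: X1) \subset Z.
    by rewrite -eS; apply/bigcupsP=> c /full.
  by move=> /(_ isT isT isT); arith.
have sv : s != v by apply/eqP=> /middle_root; arith.
have ay t : t \in X1 -> adj y (f t).
  move=> tX; have : f t \in y |: nbrs y by rewrite ey (subsetP fZ) ?imset_f.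
  rewrite in_setU1 inE => /orP[/eqP e|//]; case/setDP: ys => _.
  by rewrite -e imset_f.
have ef' := emb_shift dep_par middle_leaf sX sv ef (fun t tX _ => ay t tX).
set f' := upd _ _ _ in ef'.
have f'u2 : f' u2 = f s by rewrite /f' updE.
have imf' : f' @: X1 \subset y |: f @: (X1 :\ u2).
  apply/subsetP=> _ /imsetP[t tX ->]; rewrite /f' /upd in_setU1.
  case: (eqVneq t u2) => [_|tu]; first by rewrite imset_f ?orbT // in_setD1 su2.
  by case: (eqVneq t s) => [_|ts]; rewrite ?eqxx // imset_f ?orbT // in_setD1 tu.
have uN : f u2 \notin y |: f @: (X1 :\ u2).
  rewrite in_setU1 negb_or (imset_notin ef) ?subsetDl ?setD11 // andbT.
  by apply: contraTneq uy => ->; rewrite adj_irrefl.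
have Zu w : w \in Z -> w != f u2 -> adj (f u2) w.
  by rewrite in_setU1 inE => /orP[/eqP->|//]; rewrite eqxx.
have fs_u : f s != f u2 by apply: contraNneq su2 => /finj ->.
have fsZ : f s \in Z by apply: (subsetP fZ); apply: imset_f.
have us' : f u2 \in spots u1 f'.
  rewrite in_setD (contra (subsetP imf' _)) //= ru1 f'u2 inE adj_sym Zu //.
have leak : ~~ (nbrs (f s) \subset Z).
  by apply: capacity; rewrite // in_setU1 negb_or fs_u in_setD imset_f.
case: (stuck2 ef' us') => [|[lu]|]; [|by rewrite lu in hu|].
- rewrite /crowded f'u2 -/Z => small; case/negP: leak.
  have sub : Z :|: nbrs (f s) \subset f' @: X1 :|: Z :|: nbrs (f s) by rewrite setSU // subsetUr.
  have e : Z = Z :|: nbrs (f s).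
    by apply/eqP; rewrite eqEcard subsetUl cZ; have := subset_leq_card sub; arith.
  by apply: (subset_trans (subsetUr Z _)); rewrite -e.
case; rewrite f'u2 => /eqP ls as_ asu b11; case/negP: leak.
have sub : f u2 |: f' @: (X1 :\ u2) \subset nbrs (f s).
  rewrite subUset sub1set inE asu; apply/subsetP=> _ /imsetP[t /setD1P[tu tX] ->].
  by rewrite inE as_.
have [_ f'inj _] := ef'.
have cf' : #|f' @: (X1 :\ u2)| = #|X1 :\ u2| by apply: (card_embX1 ef'); apply: subsetDl.
have uN' : f u2 \notin f' @: (X1 :\ u2).
  apply: contra uN => /imsetP[t /setD1P[_ tX] ->]; apply: (subsetP imf'); exact: imset_f.
have cX2 := cardsD1 u2 X1; rewrite u2X in cX2.
have e : f u2 |: f' @: (X1 :\ u2) = nbrs (f s).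
  by apply/eqP; rewrite eqEcard sub cardsU1 uN' cf' ls; arith.
rewrite -e subUset sub1set setU11; apply: subset_trans (imsetS _ (subsetDl _ _)) _.
apply: subset_trans imf' _; rewrite subUset sub1set -{1}ey setU11 /=.
by apply: subset_trans (imsetS _ (subsetDl _ _)) fZ.
Qed.

(** All spots are low, hence pairwise non-adjacent. If [s] is not the root, a spot [c] is joined to
    the whole image; shifting with [c] puts [u2] at [f s], high as a neighbour of [c], and turns
    [f u2] into a high spot. *)
Lemma middle_not_high f : emb X1 f -> ~~ low (f u2) -> False.
Proof.
move=> ef hu; have [bs b1p b2p _ n0] := twig_counts; have [hb1 hb2 h3] := h_bounds.
have allow c : c \in spots u1 f -> low c.
  by move=> cs; apply/negPn/negP=> hc; apply: (middle_high ef cs hc hu).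
have cS := card_spots lu1 ef; have hd := highP hu; rewrite ru1 in cS.
have adjc c : c \in spots u1 f -> adj (f u2) c by case/setDP; rewrite ru1 inE.
have nad c c' : c \in spots u1 f -> c' \in spots u1 f -> c' \notin nbrs c.
  move=> cs cs'; rewrite inE; apply/negP=> cc.
  by have := low_indep cc (allow c cs); rewrite allow.
have tight c : c \in spots u1 f -> crowded f c ->
    nbrs c \subset (f u2 |: nbrs (f u2)) :\: spots u1 f /\ #|f u2 |: nbrs (f u2)| = h + 2.
  move=> cs /(crowded_high ef hu cs)[_ e ->]; split=> //.
  apply/subsetP=> w wc; rewrite in_setD; apply/andP; split.
    by apply/negP=> ws; have := nad c w cs ws; rewrite wc.
  by rewrite e !in_setU wc !orbT.
have Ssub : spots u1 f \subset f u2 |: nbrs (f u2).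
  by apply/subsetP=> c cs; rewrite in_setU1 inE adjc ?orbT.
have [c [c' [cs cs' cc]]] : exists c c', [/\ c \in spots u1 f, c' \in spots u1 f & c != c'].
  have : 1 < #|spots u1 f| by arith.
  by case/card_gt1P=> c [c' [? ? ?]]; exists c, c'.
have [sv|sv] := eqVneq s v.
  have n3 := middle_root sv.
  case: (stuck2 ef cs) => [crow|[_ _ b21]|[lu]]; [|by arith|by rewrite lu in hu].
  have [sub cZ] := tight c cs crow; have := subset_leq_card sub.
  by rewrite cardsDS // cZ (eqP (allow c cs)); arith.
have ac : {in X1, forall t, adj c (f t)}.
  case: (stuck2 ef cs) => [crow|[_ //]|[lu]]; last by rewrite lu in hu.
  have [sub cZ] := tight c cs crow.
  have sub2 : nbrs c \subset (f u2 |: nbrs (f u2)) :\ c :\ c'.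
    rewrite !subsetD1 (subset_trans sub (subsetDl _ _)) notin_nbrs nad //.
  have cc1 := cardsD1 c (f u2 |: nbrs (f u2)).
  have cc2 := cardsD1 c' ((f u2 |: nbrs (f u2)) :\ c).
  rewrite (subsetP Ssub _ cs) in cc1; rewrite in_setD1 eq_sym cc (subsetP Ssub _ cs') in cc2.
  have e : nbrs c = (f u2 |: nbrs (f u2)) :\ c :\ c'.
    by apply/eqP; rewrite eqEcard sub2 (eqP (allow c cs)); arith.
  move=> t tX; suff : f t \in nbrs c by rewrite inE.
  have [_ eZ _] := crowded_high ef hu cs crow.
  rewrite e !in_setD1 eZ !in_setU imset_f // andbT.
  by apply/andP; split; [case/setDP: cs' | case/setDP: cs] => _; apply: contraNneq => <-; apply: imset_f.
have ef' := emb_shift dep_par middle_leaf sX sv ef (fun t tX _ => ac t tX).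
set f' := upd _ _ _ in ef'.
have f'u2 : f' u2 = f s by rewrite /f' updE.
have [_ finj fadj] := ef.
have asu : adj (f s) (f u2) by apply: fadj.
have uc := adjc c cs.
have us' : f u2 \in spots u1 f'.
  rewrite in_setD ru1 f'u2 inE asu andbT; apply/imsetP=> [[t tX]].
  rewrite /f' /upd; case: (eqVneq t u2) => [_|tu] e.
    by move: asu; rewrite e adj_irrefl.
  move: e; case: (eqVneq t s) => [_ e|ts /finj e].
    by move: uc; rewrite e adj_irrefl.
  by rewrite e ?eqxx // in tu.
apply: (middle_high ef' us' hu); rewrite f'u2.
by apply: low_indep (allow c cs); apply: ac.
Qed.

(** If [f u2] is low, its neighbours are high, and [u2] can be moved to a spot or exchanged with its
    parent. *)
Lemma middle_parent_case : False.
Proof.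
have [bs b1p b2p _ n0] := twig_counts; have [hb1 hb2 h3] := h_bounds.
have [f ef] : exists f, emb X1 f by apply: emb_start => //; rewrite kh; arith.
have [lu|hu] := boolP (low (f u2)); last exact: middle_not_high ef hu.
have cS := card_spots lu1 ef; rewrite ru1 in cS.
have [y ys] : exists y, y \in spots u1 f.
  by apply/card_gt0P; have := degh (f u2); arith.
have uy : adj (f u2) y by case/setDP: ys; rewrite ru1 inE.
have hy := low_indep uy lu.
have yf : y \notin f @: X1 by case/setDP: ys.
have [_ finj fadj] := ef.
have efu : emb (X1 :\ u2) f by apply: emb_sub ef; apply: subsetDl.
case: (stuck2 ef ys) => [crow|[ly]|[_ au _ b11]]; last 2 first.
- by rewrite ly in hy.
- have sv : s != v by apply/eqP=> /middle_root; arith.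
  have ef' := emb_shift dep_par middle_leaf sX sv ef au.
  apply: (middle_not_high ef'); rewrite updE.
  by apply: low_indep lu; apply: au.
have [||//|ey _] := high_zone (y := y) crow.
- by rewrite !in_setU set11 ?orbT.
- by apply: subset_trans (subsetUl _ _); apply: subset_trans (subsetUr _ _); apply: subsetUr.
have ay t : t \in X1 -> adj y (f t).
  move=> tX; have : f t \in y |: nbrs y by rewrite ey !in_setU imset_f.
  by rewrite in_setU1 inE => /orP[/eqP e|//]; rewrite -e imset_f in yf.
have ef' : emb X1 (upd f u2 y).
  by apply: (emb_upd_full dep_par efu) => // t tX _; apply: ay.
by apply: (middle_not_high ef'); rewrite updE.
Qed.
End MiddleParent.

(** * Two bearers: [u1] hangs from a third vertex *)

Section SideParent.
Hypothesis rv : par u1 != v.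
Hypothesis ru2 : par u1 != u2.
Notation r := (par u1).

Let rX1' : r \in X1. Proof. exact: par_u1. Qed.
Let emb_r f : emb X1 f -> emb (X1 :\ r) f.
Proof. by apply: emb_sub; apply: subsetDl. Qed.

(** Once [r] is moved to [y], the spots are exactly the vertices of [Z] outside the image. With [y]
    and [f u2] they are at least four closed vertices in [h + 2], where three are possible. *)
Lemma side_high f y : emb X1 f -> y \in spots u1 f -> ~~ low y -> ~~ low (f u2) -> False.
Proof.
move=> ef ys hy hu; have [bs b1p b2p _ n0] := twig_counts.
case: (stuck2 ef ys) => [crow|[ly]|[lu]]; [|by rewrite ly in hy|by rewrite lu in hu].
have [uy eZ cZ] := crowded_high ef hu ys crow.
have [||//|ey _] := high_zone (y := y) crow.
- by rewrite !in_setU set11 ?orbT.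
- by apply: subset_trans (subsetUl _ _); apply: subset_trans (subsetUr _ _); apply: subsetUr.
rewrite -eZ in ey; set Z := f u2 |: nbrs (f u2) in eZ cZ ey.
have fZ : f @: X1 \subset Z by rewrite eZ -setUA subsetUl.
have yf : y \notin f @: X1 by case/setDP: ys.
have ay t : t \in X1 -> adj y (f t).
  move=> tX; have : f t \in y |: nbrs y by rewrite ey (subsetP fZ) ?imset_f.
  by rewrite in_setU1 inE => /orP[/eqP e|//]; rewrite -e imset_f in yf.
have ef' : emb X1 (upd f r y).
  by apply: (emb_upd_full dep_par (emb_r ef)) => // t tX _; apply: ay.
have fu : upd f r y u2 = f u2 by rewrite upd_neq // eq_sym.
have hu' : ~~ low (upd f r y u2) by rewrite fu.
have im : upd f r y @: X1 = y |: f @: (X1 :\ r) by rewrite imset_upd.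
have yZ : y \in Z by rewrite -ey setU11.
have fZ' : upd f r y @: X1 \subset Z.
  by rewrite im subUset sub1set yZ; apply: subset_trans (imsetS _ (subsetDl _ _)) fZ.
have full c : c \in spots u1 (upd f r y) -> nbrs c \subset Z.
  move=> cs; case: (stuck2 ef' cs) => [/(crowded_high ef' hu' cs)[_ + _]|[lc ac b21]|[lu]].
  - rewrite fu -/Z => ->; apply: subset_trans (subsetUl _ _).
    by apply: subset_trans (subsetUr _ _); apply: subsetUr.
  - apply: (leaky_spot ef' hu' _ cZ fZ' ac lc b21); first by rewrite fu.
    by rewrite upd_neq // updE fu adj_sym.
  - by rewrite lu in hu'.
have eS : spots u1 (upd f r y) = Z :\: (upd f r y @: X1).
  apply/setP=> w; rewrite !in_setD updE -ey in_setU1.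
  by case: (eqVneq w y) => [->|//]; rewrite im setU11.
have cS : #|spots u1 (upd f r y)| = b1 + b2.
  by rewrite eS cardsDS // cZ (card_embX1 ef') //; arith.
have yS : y \notin spots u1 (upd f r y) by rewrite in_setD im setU11.
have uS : f u2 \notin y |: spots u1 (upd f r y).
  rewrite in_setU1 negb_or in_setD -fu imset_f // andbT fu.
  by apply: contraNneq yf => <-; apply: imset_f.
have cS' : #|f u2 |: (y |: spots u1 (upd f r y))| = (b1 + b2).+2.
  by rewrite !cardsU1 uS yS cS.
have := closed2 (S := f u2 |: (y |: spots u1 (upd f r y))) (Z := Z).
rewrite cS' cZ -card_gt0 cS' !nbhd1U !subUset !sub1set setU11 yZ subsetUr eS subsetDl /=.
have -> : nbrs y \subset Z by rewrite -ey subsetUr.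
have -> : nbhd (Z :\: (upd f r y @: X1)) \subset Z.
  by rewrite -eS; apply/bigcupsP=> c /full.
by move=> /(_ isT isT isT); arith.
Qed.

(** All spots are low, so [f r] is high. Two crowded low spots miss each other and thus nothing else
    in [Z]; in every case some spot is joined to the whole image, and moving [r] there makes [f r] a
    high spot. *)
Lemma side_not_high f : emb X1 f -> ~~ low (f u2) -> False.
Proof.
move=> ef hu; have [bs b1p b2p _ n0] := twig_counts.
have allow c : c \in spots u1 f -> low c.
  by move=> cs; apply/negPn/negP=> hc; apply: (side_high ef cs hc hu).
have cS := card_spots lu1 ef.
have adjc c : c \in spots u1 f -> adj (f r) c by case/setDP; rewrite inE.
have hR : ~~ low (f r).
  have [c cs] : exists c, c \in spots u1 f by apply/card_gt0P; have := degh (f r); arith.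
  by apply: low_indep (allow c cs); rewrite adj_sym adjc.
have hd := highP hR.
have [c [c' [cs cs' cc]]] : exists c c', [/\ c \in spots u1 f, c' \in spots u1 f & c != c'].
  have : 1 < #|spots u1 f| by arith.
  by case/card_gt1P=> c [c' [? ? ?]]; exists c, c'.
have [y [ys ay]] : exists y, y \in spots u1 f /\ {in X1, forall t, adj y (f t)}.
  case: (stuck2 ef cs) => [crow|[_ ac _]|[lu]]; [|by exists c|by rewrite lu in hu].
  case: (stuck2 ef cs') => [crow'|[_ ac _]|[lu]]; [|by exists c'|by rewrite lu in hu].
  exists c; split=> //; have [uc eZ cZ] := crowded_high ef hu cs crow.
  have [uc' _ _] := crowded_high ef hu cs' crow'.
  set Z := f u2 |: nbrs (f u2) in eZ cZ.
  have ncc : c' \notin nbrs c.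
    by rewrite inE; apply/negP=> adjcc; have := low_indep adjcc (allow c cs); rewrite allow.
  have NZ : nbrs c \subset Z.
    rewrite eZ; apply: subset_trans (subsetUl _ _).
    by apply: subset_trans (subsetUr _ _); apply: subsetUr.
  have sub2 : nbrs c \subset Z :\ c :\ c' by rewrite !subsetD1 NZ notin_nbrs ncc.
  have cZ1 : c \in Z by rewrite in_setU1 inE uc orbT.
  have cZ2 : c' \in Z by rewrite in_setU1 inE uc' orbT.
  have cc1 := cardsD1 c Z; have cc2 := cardsD1 c' (Z :\ c).
  rewrite cZ1 in cc1; rewrite in_setD1 eq_sym cc cZ2 in cc2.
  have e : nbrs c = Z :\ c :\ c'.
    by apply/eqP; rewrite eqEcard sub2 (eqP (allow c cs)); arith.
  move=> t tX; suff : f t \in nbrs c by rewrite inE.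
  rewrite e !in_setD1 eZ !in_setU imset_f // andbT.
  by apply/andP; split; [case/setDP: cs' | case/setDP: cs] => _; apply: contraNneq => <-; apply: imset_f.
have ef' : emb X1 (upd f r y).
  by apply: (emb_upd_full dep_par (emb_r ef)) => // t tX _; apply: ay.
apply: (side_high ef' _ hR); last by rewrite upd_neq // eq_sym.
rewrite in_setD updE inE ay // andbT imset_upd // in_setU1 negb_or.
rewrite (imset_notin ef) ?subsetDl ?setD11 // andbT.
by apply: contraTneq (ay _ rX1') => ->; rewrite adj_irrefl.
Qed.

Lemma side_low f : emb X1 f -> low (f u2).
Proof. by move=> ef; apply/negPn/negP; apply: side_not_high. Qed.

(** Otherwise [f r] and [f u2] are closed in a set of [h + 1] vertices, or, together with two spots,
    in a set of [h + 2]; both exceed what local density allows. *)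
Lemma side_spot f : emb X1 f -> exists2 c, c \in spots u1 f & ~~ adj (f u2) c.
Proof.
move=> ef; have [bs b1p b2p _ n0] := twig_counts; have [_ finj _] := ef.
case: (pickP [pred c | (c \in spots u1 f) && ~~ adj (f u2) c]) => [c /andP[]|none].
  by exists c.
exfalso; have uc c : c \in spots u1 f -> adj (f u2) c.
  by move=> cs; have := none c; rewrite /= cs => /negbFE.
have lu := side_low ef; have cA := eqP lu; set A := nbrs (f u2) in cA.
have cUA : #|f u2 |: A| = h.+1 by rewrite cardsU1 notin_nbrs cA.
have Ru : f r != f u2 by apply: contraNneq ru2 => /finj ->.
have NR := nbrs_last u1 f.
have [fA|/subsetPn[w /imsetP[t tX ew] wA]] := boolP (f @: X1 \subset f u2 |: A).
  have := closed2 (S := [set f r; f u2]) (Z := f u2 |: A).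
  rewrite cards2 Ru cUA -card_gt0 cards2 !subUset !sub1set setU11 (subsetP fA) ?imset_f //=.
  rewrite nbhd1U nbhd1 subUset subsetUr andbT.
  have -> : nbrs (f r) \subset f u2 |: A.
    apply: subset_trans NR _; rewrite subUset (subset_trans (subsetDl _ _) fA) /=.
    by apply/subsetP=> c cs; rewrite in_setU1 inE uc ?orbT.
  by move=> /(_ isT isT isT); arith.
pose W := w |: (f u2 |: A).
have cW : #|W| = h + 2 by rewrite cardsU1 wA cUA; arith.
have full c : c \in spots u1 f -> c |: nbrs c = W /\ f @: X1 \subset W.
  move=> cs; case: (stuck2 ef cs) => [crow|[lc _ _]|[_ au _ _]].
  - have [|||e _] := high_zone (y := c) crow.
    + by rewrite !in_setU set11 ?orbT.
    + by apply: subset_trans (subsetUl _ _); apply: subset_trans (subsetUr _ _); apply: subsetUr.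
    + by apply: low_indep lu; apply: uc.
    have eW : W = f @: X1 :|: (c |: nbrs c) :|: A.
      apply/eqP; rewrite eqEcard cW; apply/andP; split; last exact: crow.
      by rewrite !subUset !sub1set ew !in_setU !imset_f //= subsetUr.
    by rewrite e eW -setUA subsetUl.
  - by have := low_indep (uc c cs) lu; rewrite lc.
  - case/negP: wA; rewrite in_setU1 ew inE; case: (eqVneq t u2) => [->|tu]; rewrite ?eqxx //.
    by rewrite au ?orbT.
have dR := degh (f r).
have cS : 2 <= #|spots u1 f|.
  have [uR|uR] := boolP (adj (f u2) (f r)).
    by have := highP (low_indep uR lu); have := card_spots lu1 ef; arith.
  have sub : nbrs (f r) \subset (f @: X1 :\ f r :\ f u2) :|: spots u1 f.
    apply/subsetP=> y /[dup] yR /(subsetP NR); rewrite !in_setU => /orP[yf|->]; last by rewrite orbT.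
    rewrite in_setD1 yf andbT; apply/orP; left.
    by apply: contraNneq uR => <-; move: yR; rewrite inE adj_sym.
  have := subset_leq_card sub; rewrite cardsU.
  have := cardsD1 (f r) (f @: X1); have := cardsD1 (f u2) (f @: X1 :\ f r).
  by rewrite in_setD1 eq_sym Ru !imset_f // (card_embX1 ef) //; arith.
have [c0 cs0] : exists c, c \in spots u1 f by apply/card_gt0P; arith.
have [_ fW] := full c0 cs0.
have SW : spots u1 f \subset W.
  by apply/subsetP=> c /full[<- _]; apply: setU11.
have RS : f r \notin spots u1 f by rewrite in_setD imset_f.
have uS : f u2 \notin f r |: spots u1 f.
  by rewrite in_setU1 negb_or eq_sym Ru in_setD imset_f.
have cS' : #|f u2 |: (f r |: spots u1 f)| = #|spots u1 f|.+2 by rewrite !cardsU1 uS RS.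
have := closed2 (S := f u2 |: (f r |: spots u1 f)) (Z := W).
rewrite cS' cW -card_gt0 cS' !subUset !sub1set !(subsetP fW) ?imset_f // SW.
rewrite !nbhd1U !subUset.
have -> : nbrs (f u2) \subset W by apply: subset_trans (subsetUr _ _); apply: subsetUr.
have -> : nbrs (f r) \subset W.
  by apply: subset_trans NR _; rewrite subUset SW (subset_trans (subsetDl _ _) fW).
have -> : nbhd (spots u1 f) \subset W.
  by apply/bigcupsP=> c /full[<- _]; apply: subsetUr.
by move=> /(_ isT isT isT); arith.
Qed.

Lemma below_u2 w : w \in T0 -> par w = u2 -> exists n, iter n par u1 = w.
Proof.
move=> wT pw; have wv : w != v by apply: contraNneq u2v => e; rewrite -pw e par_root.
have dw := dep_parS wv; rewrite pw in dw.
have [l ll [n en]] := tleaf_above wT wv.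
case: (tleaf_pair ll) en => ->; first by exists n.
by move=> e; have := dep_iter n u2; rewrite e dw ltnn.
Qed.

(* In the last configuration the core is the path [v], [u2], [par u1], [u1]: all neighbours
   outside [A] of a vertex of [A :\ x] have neighbourhood [A], and local density forces more
   than [h] vertices with that neighbourhood. *)
Lemma side_parent_case : False.
Proof.
have [bs b1p b2p _ n0] := twig_counts; have [hb1 hb2 h3] := h_bounds.
have [f ef] : exists f, emb X1 f by apply: emb_start => //; rewrite kh; arith.
have [c cs nuc] := side_spot ef; have [eA cA fA] := crowded_nonadj ef cs nuc.
have [fv finj fadj] := ef; have lu := side_low ef.
have cf : c \notin f @: X1 by case/setDP: cs.
have lc : low c by rewrite /low eA cA.
have u2t t : t \in X1 -> t != u2 -> adj (f u2) (f t).
  move=> tX tu; have := subsetP fA _ (imset_f f tX); rewrite in_setU1 inE.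
  by case/orP=> [/eqP /finj e|//]; rewrite e ?eqxx // in tu.
have ac t : t \in X1 -> t != u2 -> adj c (f t).
  by move=> tX tu; have := u2t t tX tu; rewrite -!in_set -/(nbrs c) eA.
have hR : ~~ low (f r) by apply: low_indep lu; apply: u2t.
have hs t : t \in X1 -> t != u2 -> ~~ low (f t).
  by move=> tX tu; apply: low_indep lu; apply: u2t.
have cfD (w : T) : c \notin f @: (X1 :\ w).
  by apply: contra cf; apply/subsetP/imsetS/subsetDl.
(* The spot [c] is a twin of [f u2]. Unless [par r = u2] and [par u2 = v], some move of [r] to [c]
   either lets [u2] take a high image or leads to two adjacent low vertices. *)
have [pu2|pu2] := eqVneq (par u2) r.
  have lfu2 : tleaf X1 u2.
    split=> // w /setD1P[wu1 wT]; apply/eqP=> pw.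
    have wv : w != v by apply: contraNneq u2v => e; rewrite -pw e par_root.
    have [[|n] en] := below_u2 wT pw; first by rewrite -en eqxx in wu1.
    have := dep_parS wv; rewrite pw -en iterSr; have := dep_iter n r.
    by have := dep_parS u2v; rewrite pu2; arith.
  have efr : emb (X1 :\ u2 :\ r) f.
    by apply: emb_sub ef; apply: subset_trans (subsetDl _ _) (subsetDl _ _).
  have ef1 : emb (X1 :\ u2) (upd f r c).
    apply: (emb_upd dep_par efr) => //.
    - by rewrite in_setD1 ru2.
    - by apply: contra cf; apply/subsetP/imsetS/(subset_trans (subsetDl _ _) (subsetDl _ _)).
    - by case/setD1P=> pr pX; rewrite adj_sym ac.
    - by move=> t /setD1P[tu tX] _ _; apply: ac.
  have ef2 : emb X1 (upd (upd f r c) u2 (f r)).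
    apply: (emb_upd_leaf dep_par ef1 lfu2); last by rewrite pu2 updE ac.
    have rXu : r \in X1 :\ u2 by rewrite in_setD1 ru2.
    rewrite (imset_upd _ _ rXu) in_setU1 negb_or; apply/andP; split.
      by apply: contraTneq (ac r rX1' ru2) => ->; rewrite adj_irrefl.
    apply/imsetP=> [[t /setD1P[tr /setD1P[_ tX]] /finj e]].
    by rewrite e ?eqxx // in tr.
  by apply: (side_not_high ef2); rewrite updE.
have [pr|pr] := eqVneq (par r) u2; last first.
  have ef1 : emb X1 (upd f r c).
    apply: (emb_upd dep_par (emb_r ef)) => //.
    - by move=> pX; rewrite adj_sym ac.
    - by move=> t tX _ pt; apply: ac => //; apply: contraNneq pu2 => <-; rewrite pt.
  have fu : upd f r c u2 = f u2 by rewrite upd_neq // eq_sym.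
  have [c' cs' nuc'] := side_spot ef1; have [eA' cA' _] := crowded_nonadj ef1 cs' nuc'.
  have lc' : low c' by rewrite /low eA' cA'.
  have cc' : adj c c' by case/setDP: cs'; rewrite updE inE.
  by have := low_indep cc' lc; rewrite lc'.
have itr n : iter n.+2 par u1 = iter n par u2 by rewrite !iterSr pr.
have rv2 : par u2 != u2 by apply: (par_neq dep_par).
have [sv|sv] := eqVneq (par u2) v; last first.
  have lX : tleaf (X1 :\ r) u2.
    split=> //; first by rewrite in_setD1 eq_sym ru2.
    move=> w /setD1P[wr /setD1P[wu1 wT]]; apply/eqP=> pw.
    have [[|[|n]] en] := below_u2 wT pw.
    - by rewrite -en eqxx in wu1.
    - by rewrite -en eqxx in wr.
    have wv : w != v by apply: contraNneq u2v => e; rewrite -pw e par_root.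
    by have := dep_parS wv; rewrite pw -en itr; have := dep_iter n u2; arith.
  have sX : par u2 \in X1.
    rewrite in_setD1 (proj2 rT0) // andbT; apply/eqP=> e.
    by have := dep_parS u2v; have := dep_parS u1v; have := dep_parS rv; rewrite e pr; arith.
  have sXr : par u2 \in X1 :\ r by rewrite in_setD1 pu2.
  have u2t' t : t \in X1 :\ r -> t != u2 -> adj (f u2) (f t) by case/setD1P=> _; apply: u2t.
  have ef1 := emb_shift dep_par lX sXr sv (emb_r ef) u2t'.
  have ef2 : emb X1 (upd (upd (upd f (par u2) (f u2)) u2 (f (par u2))) r c).
    apply: (emb_upd dep_par ef1) => //.
    - apply: contra cf => /imsetP[t /setD1P[tr tX] ->]; rewrite /upd.
      by case: (eqVneq t u2) => _; [|case: (eqVneq t (par u2)) => _]; apply: imset_f.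
    - by move=> _; rewrite pr updE adj_sym ac.
    - move=> t tX tv pt; have tu : t != u2 by apply: contraNneq pu2 => <-; rewrite pt.
      rewrite !upd_neq ?ac //; apply/eqP=> e.
      by have := dep_parS u2v; have := dep_parS tv; have := dep_parS rv; rewrite pt e pr; arith.
  apply: (side_not_high ef2); rewrite upd_neq; last by rewrite eq_sym.
  by rewrite updE hs.
have itv n : iter n par v = v by elim: n => //= n ->.
have X1r : X1 :\ r = [set v; u2].
  apply/setP=> w; rewrite !(in_setD1, in_set2); apply/idP/idP; last first.
    case/orP=> /eqP ->; first by rewrite eq_sym rv eq_sym u1v; case: rT0.
    by rewrite eq_sym ru2 eq_sym u12.
  case/and3P=> wr wu1 wT; have [//|wv] := eqVneq w v; rewrite orFb.
  have [l ll [n en]] := tleaf_above wT wv; case: (tleaf_pair ll) en => ->; last first.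
    case: n => [/= <-|n]; first by rewrite eqxx.
    by rewrite iterSr sv itv => e; rewrite e eqxx in wv.
  case: n => [e|[e|n]]; [by rewrite -e eqxx in wu1|by rewrite -e eqxx in wr|].
  rewrite itr; case: n => [/= <-|n]; first by rewrite eqxx.
  by rewrite iterSr sv itv => e; rewrite e eqxx in wv.
set A := nbrs (f u2) in eA cA fA.
have xA : x \in A.
  have := u2t v vX; rewrite fv eq_sym u2v => /(_ isT); by rewrite -in_set.
pose Y := [set y | nbrs y == A].
have uY : f u2 \in Y by rewrite inE.
have AY a : a \in A -> a \notin Y.
  by move=> aA; rewrite inE; apply/eqP=> e; rewrite -e (negbTE (notin_nbrs a)) in aA.
(* [r] may be placed at [z]. A neighbour of [z] outside [A] and different from [f u2] is then a spot
   not joined to [f u2], hence a twin of it. *)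
have NA z : z \in A -> z != x -> nbrs z \subset A :|: Y.
  move=> zA zx; have uz : adj (f u2) z by rewrite inE in zA.
  have zN : z \notin f @: (X1 :\ r).
    rewrite X1r imsetU1 imset_set1 fv in_set2 negb_or zx /=.
    by apply: contraTneq uz => ->; rewrite adj_irrefl.
  have efz : emb X1 (upd f r z).
    apply: (emb_upd dep_par (emb_r ef)) => //; first by rewrite pr.
    move=> t tX tv pt; have : t \in X1 :\ r by rewrite in_setD1 tX andbT -pt eq_sym (par_neq dep_par).
    by rewrite X1r in_set2 (negbTE tv) => /eqP e; have := rv; rewrite -pt e sv eqxx.
  have fzu : upd f r z u2 = f u2 by rewrite upd_neq // eq_sym.
  apply/subsetP=> w wz; rewrite in_setU.
  have [->|wx] := eqVneq w x; first by rewrite xA.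
  have [->|wu] := eqVneq w (f u2); first by rewrite uY orbT.
  have ws : w \in spots u1 (upd f r z).
    rewrite in_setD updE wz andbT imset_upd // X1r imsetU1 imset_set1 fv !inE !negb_or wx wu !andbT.
    by apply: contraTneq wz => ->; apply: notin_nbrs.
  have [uw|uw] := boolP (adj (f u2) w); first by rewrite inE uw.
  have [|ew _ _] := crowded_nonadj efz ws; first by rewrite fzu.
  by rewrite [w \in Y]inE ew fzu eqxx orbT.
have disAY : [disjoint A :\ x & Y].
  by apply/pred0P=> a /=; apply/negbTE/negP=> /andP[/setD1P[_ /AY/negbTE ->]].
have cAx := cardsD1 x A; rewrite xA in cAx.
have cY1 : 0 < #|Y| by apply/card_gt0P; exists (f u2).
have cQ : #|(A :\ x) :|: Y| = h.-1 + #|Y|.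
  by rewrite cardsU disjoint_setI0 // cards0; arith.
have outx (S : {set G}) : S \subset A :|: Y -> #|S :\: ((A :\ x) :|: Y)| <= 1.
  move=> SAY; rewrite -(cards1 x); apply: subset_leq_card; apply/subsetP=> w /setDP[/(subsetP SAY)].
  rewrite !in_setU in_setD1 inE => /orP[->|->]; rewrite ?orbT // andbT.
  by case: eqVneq.
have := denseG (S := (A :\ x) :|: Y); rewrite -card_gt0 cQ addn_gt0 cY1 orbT => /(_ isT).
rewrite (eq_bigl [predU A :\ x & Y]); last by move=> u; rewrite in_setU.
rewrite bigU //=.
have le1 : \sum_(u in A :\ x) (#|nbrs u| + #|nbrs u :\: ((A :\ x) :|: Y)|) <=
    \sum_(u in A :\ x) (h + #|Y|).
  apply: leq_sum => z /setD1P[zx zA]; have Nz := NA z zA zx; have o := outx _ Nz.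
  have : nbrs z \subset (A :\ z) :|: Y.
    apply/subsetP=> w wz; have := subsetP Nz w wz; rewrite !in_setU in_setD1.
    by have -> : w != z by apply: contraTneq wz => ->; apply: notin_nbrs.
  move/subset_leq_card; rewrite cardsU; have := cardsD1 z A; rewrite zA.
  by move: o; arith.
have le2 : \sum_(u in Y) (#|nbrs u| + #|nbrs u :\: ((A :\ x) :|: Y)|) <=
    \sum_(u in Y) (h + 1).
  apply: leq_sum => y; rewrite inE => /eqP ->; rewrite cA leq_add2l.
  by apply: outx; apply: subsetUl.
rewrite !sum_nat_const in le1 le2 => dense.
(* The edge count amounts to [#|Y| > (h - 1) ^ 2], which suffices as [h >= 3]. *)
have cYh : h < #|Y|.
  have eh : #|A :\ x| = h.-1 by arith.
  rewrite eh in le1; set y := #|Y| in le1 le2 dense *.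
  set s1 := (\sum_(u in A :\ x) _) in le1 dense; set s2 := (\sum_(u in Y) _) in le2 dense.
  clear -le1 le2 dense h3 kh; move: s1 s2 le1 le2 dense => s1 s2; rewrite kh.
  case: h h3 => // h' h3' /=; nia.
apply: (complete_bipartite_case xA cA cYh) => y; rewrite inE => /eqP ->.
exact: subxx.
Qed.
End SideParent.

Lemma two_bearers_case : False.
Proof.
have [rv|rv] := eqVneq (par u1) v; first exact: root_parent_case rv.
have [ru2|ru2] := eqVneq (par u1) u2; first exact: middle_parent_case ru2.
exact: side_parent_case rv ru2.
Qed.
End TwoBearers.

Lemma core_case : (q != 0 -> 2 * N <= k + q + 4) ->
  {in U, forall u, #|twigs [set u]| <= #|twigs [set v]|} -> False.
Proof.
move=> leN root_max; have [q0|q0] := eqVneq q 0.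
  have U0 : U = set0 by apply: cards0_eq.
  have T0v : T0 \subset [set v].
    apply/subsetP=> w wT; rewrite inE; apply/negPn/negP=> wv.
    have [u lu] := rooted_leaf par_root dep_par wT wv.
    by have := bearP lu; rewrite U0 inE.
  have [f ef] : exists f, emb T0 f.
    by apply: emb_start => //; have := subset_leq_card T0v; rewrite cards1; arith.
  by have [I [IU /set0Pn[u uI] _ _]] := stuck ef; have := subsetP IU u uI; rewrite U0 inE.
have {}leN := leN q0.
have [u1 lu1] : exists u, tleaf T0 u by apply: exists_tleaf; rewrite -card_gt0 lt0n.
have u1U := bearP lu1.
have [q1|q1] := eqVneq q 1.
  apply: single_bearer_case => //.
  have [w eU] := cards1P (introT eqP q1).
  by have := root_max _ u1U; move: u1U; rewrite eU inE => /eqP ->.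
have [small|large] := leqP (2 * N) (k + q + 3); first by apply: many_twigs_case => //; lia.
have [q2|q2] := eqVneq q 2; last by apply: many_bearers_case leN _ lu1; lia.
have [u2 u2K] : exists u2, u2 \in U :\ u1.
  by apply/card_gt0P; have := cardK lu1; arith.
have [u21 u2U] := setD1P u2K.
have u12 : u1 != u2 by rewrite eq_sym.
(* Here [2 * N = k + q + 4 = k + 6], so [k] is even and [N - 3] is its half. *)
apply: (two_bearers_case (h := N - 3) lu1 u12 _ _ _ root_max); [|by arith..].
by apply/esym/eqP; rewrite eqEcard subUset !sub1set u1U u2U cards2 u12 q2.
Qed.
End Core.

(** * Trees and dense graphs *)

Section TreeStructure.
Variable T : sgraph.
Hypothesis treeT : is_tree T.
Variable v : T.

Lemma connect_walk u : exists n, [exists p : n.-tuple T, path adj v p && (last v p == u)].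
Proof.
have [[_ /(_ v u) /connectP[p vp ->]] _] := treeT.
by exists (size p); apply/existsP; exists (in_tuple p); rewrite vp eqxx.
Qed.

Definition depth u := ex_minn (connect_walk u).

Lemma walk_depth u p : path adj v p -> last v p = u -> depth u <= size p.
Proof.
move=> vp lp; rewrite /depth; case: ex_minnP => m _; apply.
by apply/existsP; exists (in_tuple p); rewrite vp lp eqxx.
Qed.

Lemma depth_walk u : exists p, [/\ path adj v p, last v p = u & size p = depth u].
Proof.
rewrite /depth; case: ex_minnP => m /existsP[p /andP[vp /eqP lp]] _.
by exists p; rewrite size_tuple.
Qed.

Lemma parent_exists u : u != v -> exists w : T, adj w u && (depth u == (depth w).+1).
Proof.
move=> uv; have [p [vp lp sp]] := depth_walk u.
case/lastP: p vp lp sp => [|p w]; first by move=> _ /= e; rewrite e eqxx in uv.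
rewrite rcons_path last_rcons size_rcons => /andP[vp wu] e sp; subst w.
have le := walk_depth vp erefl; exists (last v p); rewrite wu.
have [p' [vp' lp' sp']] := depth_walk (last v p).
have := walk_depth (p := rcons p' u) (u := u).
rewrite rcons_path last_rcons size_rcons vp' lp' wu => /(_ isT erefl).
by move=> le'; apply/eqP; lia.
Qed.

Definition parent u := if u == v then v else odflt v [pick w | adj w u && (depth u == (depth w).+1)].

Lemma parent_root : parent v = v. Proof. by rewrite /parent eqxx. Qed.

Lemma parentP u : u != v -> adj (parent u) u /\ depth u = (depth (parent u)).+1.
Proof.
move=> uv; rewrite /parent (negbTE uv); case: pickP => [w /andP[wu /eqP e]|none] //.
by have [w] := parent_exists uv; rewrite none.
Qed.

(** The parent links join every vertex to the root, so any other edge would close a cycle with a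
    path of links between its ends. *)
Lemma adj_parent u w : adj u w -> (u != v /\ parent u = w) \/ (w != v /\ parent w = u).
Proof.
move=> uw; pose e := [rel a b : T | ((a != v) && (parent a == b)) || ((b != v) && (parent b == a))].
have e_adj : subrel e adj.
  move=> a b /= /orP[/andP[av /eqP <-]|/andP[bv /eqP <-]]; last by case: (parentP bv).
  by rewrite adj_sym; case: (parentP av).
have e_sym : connect_sym e.
  by apply: sym_connect_sym => a b /=; rewrite orbC.
have to_root n a : depth a < n -> connect e a v.
  elim: n a => // n IHn a lea; have [->|av] := eqVneq a v; first exact: connect0.
  apply: connect_trans (connect1 _) (IHn (parent a) _); first by rewrite /= av eqxx.
  by have [_ d] := parentP av; lia.
have : connect e u w.
  by apply: connect_trans (to_root _ u (ltnSn _)) _; rewrite e_sym; apply: to_root (ltnSn _).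
case/connectP=> p0 ep0 lw; move: lw; case: (shortenP ep0) => p ep up _ lw.
case: p ep up lw => [|a [|b p]] ep up lw.
- by move: uw; rewrite lw adj_irrefl.
- move: ep; rewrite /= andbT lw /= => /orP[/andP[? /eqP ?]|/andP[? /eqP ?]]; [left|right]; split=> //.
have [_ /(_ [:: u, a, b & p] isT) []] := treeT.
rewrite /ucycle up andbT /cycle rcons_path (sub_path e_adj ep) /=.
by rewrite adj_sym; move: uw; rewrite lw.
Qed.

Lemma card_tree : #|T| = (nedges T).+1.
Proof.
pose edge u := [set u; parent u].
have -> : nedges T = #|edge @: [set~ v]|.
  congr #|pred_of_set _|; apply/setP=> E; apply/imsetP/imsetP => [[[a b]]|[u]].
    rewrite inE /= => /adj_parent[] [av pa] ->.
      by exists a; rewrite ?inE // /edge pa.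
    by exists b; rewrite ?inE // /edge pa setUC.
  rewrite !inE => uv ->; exists (u, parent u) => //.
  by rewrite inE /= adj_sym; case: (parentP uv).
rewrite card_in_imset; first by rewrite cardsC1; have := max_card [set v]; rewrite cards1; lia.
move=> u w; rewrite !inE => uv wv e.
have : u \in edge w by rewrite -e !inE eqxx.
have : w \in edge u by rewrite e !inE eqxx.
rewrite !inE => /orP[/eqP //|/eqP eu] /orP[/eqP //|/eqP ew].
have [_ d1] := parentP uv; have [_ d2] := parentP wv.
by rewrite -eu in d1; rewrite -ew in d2; lia.
Qed.
End TreeStructure.

Lemma containsP (G T : sgraph) :
  reflect (contains G T) [exists f : {ffun T -> G},
    injectiveb f && [forall x, forall y, adj x y ==> adj (f x) (f y)]].
Proof.
apply: (iffP existsP) => [[f /andP[/injectiveP finj /forallP fadj]]|[f [finj fadj]]].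
  by exists f; split=> // x y; apply/implyP; have /forallP := fadj x.
exists (finfun f); apply/andP; split; first by apply/injectiveP=> x y; rewrite !ffunE => /finj.
apply/forallP=> x; apply/forallP=> y; apply/implyP=> xy; rewrite !ffunE; exact: fadj.
Qed.

Lemma leafP (T : sgraph) (u : T) : reflect (exists w, nbrs u = [set w]) (u \in leaves T).
Proof. rewrite inE; exact: cards1P. Qed.

Lemma leaf_nbr (T : sgraph) (u a b : T) : u \in leaves T -> adj u a -> adj u b -> a = b.
Proof.
case/leafP=> w Nu ua ub; have : a \in nbrs u by rewrite inE.
have : b \in nbrs u by rewrite inE.
by rewrite Nu !inE => /eqP -> /eqP ->.
Qed.

Definition twig_count (T : sgraph) (u : T) := #|[set y in leaves T | adj u y]|.

Section RootedAtPreleaf.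
Variable T : sgraph.
Hypothesis treeT : is_tree T.
Variable v : T.
Hypothesis preleaf_v : v \in preleaves T.
Notation par := (parent treeT v).
(** The root is added explicitly because it is itself a leaf when [T] is a single edge. *)
Let core := v |: ~: leaves T.

Lemma parent_core u : par u \in core.
Proof.
rewrite !inE; have [//|pv] := eqVneq (par u) v; rewrite orFb.
have uv : u != v by apply: contraNneq pv => ->; rewrite parent_root.
have [a1 d1] := parentP treeT uv; have [a2 d2] := parentP treeT pv.
apply/negP=> leaf; have := leaf_nbr (u := par u) (a := u) (b := par (par u)).
rewrite inE leaf a1 [adj (par u) _]adj_sym a2 => /(_ isT isT isT) e.
by rewrite -e in d2; lia.
Qed.

Lemma rooted_core : rooted v par core.
Proof. by split=> [|u _]; [rewrite setU11 | apply: parent_core]. Qed.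

Lemma notin_core l : (l \notin core) = (l != v) && (l \in leaves T).
Proof. by rewrite in_setU1 in_setC negb_or negbK. Qed.

Lemma bearers_core u : tleaf v par core u -> u \in bearers v par core.
Proof.
case=> uc uv chu; have [a1 d1] := parentP treeT uv.
have ul : u \notin leaves T.
  by move: uc; rewrite in_setU1 (negbTE uv) in_setC.
have [w /setD1P[wp Nw]] : exists w, w \in nbrs u :\ par u.
  apply/card_gt0P; have := cardsD1 (par u) (nbrs u).
  rewrite [par u \in _]inE adj_sym a1; move: ul; rewrite inE /degree -/(nbrs u).
  by move=> /eqP ne e; lia.
rewrite inE in Nw; case: (adj_parent treeT v Nw) => [[_ e]|[wv pw]].
  by rewrite e eqxx in wp.
rewrite in_setD1 uv; apply/imsetP; exists w => //; rewrite in_setC.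
by apply/negP=> /chu; rewrite pw eqxx.
Qed.

Lemma leaf_parent u y : v \notin leaves T -> y \in leaves T -> adj u y -> par y = u.
Proof.
move=> vl yl uy; case: (adj_parent treeT v uy) => [[uv pu]|[]//].
have := parent_core u; rewrite pu in_setU1 in_setC yl orbF => /eqP yv.
by rewrite -yv yl in vl.
Qed.

(** A core vertex of least depth besides the root is adjacent to [v], and so is a leaf, because [v]
    is a preleaf; these are two different neighbours. *)
Lemma root_not_leaf : bearers v par core != set0 -> v \notin leaves T.
Proof.
case/set0Pn=> u0 /setD1P[u0v /imsetP[l _ e0]]; have u0c := parent_core l; rewrite -e0 in u0c.
have P0 : (u0 \in core) && (u0 != v) by rewrite u0c.
case: (arg_minnP (P := fun u => (u \in core) && (u != v)) (depth treeT v) P0) => u /andP[uc uv] minu.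
have [a1 d1] := parentP treeT uv.
have pv : par u = v.
  apply/eqP/negPn/negP=> pv; have := minu (par u); rewrite parent_core pv => /(_ isT).
  by rewrite d1 ltnn.
have [y yl vy] : exists2 y, y \in leaves T & adj v y.
  by move: preleaf_v; rewrite inE => /exists_inP[y yl vy]; exists y.
apply/negP=> vl; rewrite pv in a1; have e := leaf_nbr vl a1 vy.
by move: uc; rewrite in_setU1 (negbTE uv) in_setC e yl.
Qed.

Lemma twigs_core u : v \notin leaves T -> #|twigs par core [set u]| = twig_count u.
Proof.
move=> vl; congr #|pred_of_set _|; apply/setP=> l; rewrite in_twigs notin_core in_set1 in_set.
have [ll|] := boolP (l \in leaves T); last by rewrite andbF.
have lv : l != v by apply: contraNneq vl => <-.
rewrite lv /=; apply/eqP/idP => [<-|ul]; first by case: (parentP treeT lv).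
exact: leaf_parent.
Qed.

Lemma card_preleaves : v \notin leaves T -> #|preleaves T| = #|bearers v par core|.+1.
Proof.
move=> vl; have -> : preleaves T = v |: bearers v par core.
  apply/setP=> u; rewrite in_setU1; have [->|uv] := eqVneq u v; first by rewrite preleaf_v.
  rewrite in_setD1 uv [LHS]inE; apply/exists_inP/imsetP => [[y yl uy]|[l]].
    exists y; last by rewrite (leaf_parent vl yl uy).
    by rewrite in_setC notin_core yl andbT; apply: contraNneq vl => <-.
  rewrite in_setC notin_core => /andP[lv ll] ->; exists l => //.
  by case: (parentP treeT lv).
by rewrite cardsU1 in_setD1 eqxx.
Qed.

Lemma preleaf_core_case (k : nat) (G : sgraph) (x : G) :
  nedges T = k -> k <= (twig_count v).*2 + #|preleaves T| + 1 ->
  {in preleaves T, forall u, twig_count u <= twig_count v} ->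
  locally_dense G k -> k <= #|nbrs x| -> contains G T.
Proof.
move=> ek lek maxv denseG xdeg; case: (containsP G T) => [//|notT]; exfalso.
have cT : #|T| = k.+1 by rewrite (card_tree treeT v) ek.
have noT : forall z g, ~ tree_emb v par (z : G) setT g.
  move=> z g [_ ginj gadj]; case: notT; exists g; split.
    by move=> a b; apply: ginj; rewrite inE.
  move=> a b /(adj_parent treeT v) [] [uv <-]; last by apply: gadj; rewrite ?inE.
  by rewrite adj_sym; apply: gadj; rewrite ?inE.
have depS u : u != v -> depth treeT v u = (depth treeT v (par u)).+1.
  by case/(parentP treeT).
have twigP l : l \notin core -> par l \in core by move=> _; apply: parent_core.
apply: (core_case (parent_root treeT v) depS rooted_core twigP bearers_core cT denseG xdeg noT).
  move=> q0; have vl : v \notin leaves T.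
    by apply: root_not_leaf; apply: contra q0 => /eqP ->; rewrite cards0.
  (* Since [k + 1] is [N] plus the number of leaves at [v], and [p = q + 1], eliminating that number
     gives [2 * N <= k + q + 4]. *)
  have := card_twigs v par core cT; rewrite twigs_core //.
  by move: lek; rewrite card_preleaves // -addnn; lia.
move=> u uU; have U0 : bearers v par core != set0 by apply/set0Pn; exists u.
have vl := root_not_leaf U0; rewrite !twigs_core //; apply: maxv.
have [_ /imsetP[l]] := setD1P uU; rewrite in_setC notin_core => /andP[lv ll] ->.
by rewrite inE; apply/exists_inP; exists l => //; case: (parentP treeT lv).
Qed.
End RootedAtPreleaf.

(** * Reduction to locally dense graphs *)

Lemma sum_nbrs_in_out (G : sgraph) (S : {set G}) :
  \sum_(u in ~: S) #|nbrs u :&: S| = \sum_(u in S) #|nbrs u :\: S|.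
Proof.
pose E (u w : G) : nat := adj u w.
have nb (u : G) (A : {set G}) : #|nbrs u :&: A| = \sum_(w in A) E u w.
  rewrite -sum1_card big_mkcond [RHS]big_mkcond /=; apply: eq_bigr => w _.
  by rewrite !inE /E; case: adj; case: (w \in A).
under eq_bigr => u _ do rewrite nb.
rewrite exchange_big; apply: eq_bigr => w _; rewrite setDE nb.
by apply: eq_bigr => u _; rewrite /E adj_sym.
Qed.

Definition induced (G : sgraph) (A : {set G}) : sgraph :=
  @SGraph {u : G | u \in A} (fun u w => adj (val u) (val w))
    (fun u w => adj_sym (val u) (val w)) (fun u => adj_irrefl (val u)).

Lemma sum_nbrs_induced (G : sgraph) (A : {set G}) :
  \sum_(u : induced A) #|nbrs u| = \sum_(u in A) #|nbrs u :&: A|.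
Proof.
have nb (u : induced A) : #|nbrs u| = #|nbrs (val u) :&: A|.
  rewrite -(card_imset _ val_inj); congr #|pred_of_set _|; apply/setP=> w.
  apply/imsetP/setIP => [[w' uw ->]|[uw wA]].
    by split; [move: uw; rewrite !inE | exact: valP].
  by exists (exist _ w wA) => //; move: uw; rewrite !inE.
under eq_bigr => u _ do rewrite nb.
rewrite [RHS](reindex_omap (val : induced A -> G) insub) /=; last first.
  by move=> w wA; rewrite insubT.
by apply: eq_bigl => -[w wA] /=; rewrite wA insubT /= eqxx.
Qed.

Lemma dense_vertex (G : sgraph) (k : nat) :
  k * #|G| < \sum_(u : G) #|nbrs u| + #|G| -> exists x : G, k <= #|nbrs x|.
Proof.
move=> dense; apply/existsP; apply: contraLR dense => /existsPn small; rewrite -leqNgt.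
rewrite -[X in _ + X]sum1_card -big_split /= mulnC -sum_nat_const.
by apply: leq_sum => u _; have := small u; rewrite addn1 -ltnNge.
Qed.

(** Deleting a set [S] that meets few edges keeps the graph dense: the degree sum drops by the
    degrees in [S] and, seen from the other side, by the edges leaving [S]. *)
Lemma dense_contains (T : sgraph) (k : nat) :
  (forall G : sgraph, locally_dense G k -> forall x : G, k <= #|nbrs x| -> contains G T) ->
  forall G : sgraph, k * #|G| < \sum_(u : G) #|nbrs u| + #|G| -> contains G T.
Proof.
move=> loc G; have [n] := ubnP #|G|; elim: n G => // n IHn G leG dense.
case: (pickP [pred S : {set G} | (S != set0) &&
  (\sum_(u in S) (#|nbrs u| + #|nbrs u :\: S|) + #|S| <= k * #|S|)]) => [S /andP[S0 sparse]|none].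
  have cS := cardsC S; have cH : #|induced (~: S)| = #|~: S| by rewrite card_sig; apply: eq_card.
  rewrite -card_gt0 in S0.
  have [||f [finj fadj]] := IHn (induced (~: S)); rewrite ?cH; first by lia.
    rewrite sum_nbrs_induced; move: dense.
    rewrite (bigID (mem S)) /= (eq_bigl (mem (~: S)) _ (P1 := fun i => i \notin S)); last first.
      by move=> u; rewrite !inE.
    have -> : \sum_(u in ~: S) #|nbrs u| =
        \sum_(u in ~: S) #|nbrs u :&: S| + \sum_(u in ~: S) #|nbrs u :&: ~: S|.
      by rewrite -big_split /=; apply: eq_bigr => u _; rewrite -setDE cardsID.
    rewrite sum_nbrs_in_out; move: sparse; rewrite big_split /= -cS mulnDr; lia.
  exists (val \o f); split; first by move=> a b /val_inj /finj.
  by move=> a b /fadj.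
have [x xdeg] := dense_vertex dense; apply: (loc G _ x xdeg) => S S0.
by have := none S; rewrite /= S0 /= ltnNge => ->.
Qed.

Lemma double_nedges (G : sgraph) : (nedges G).*2 <= \sum_(u : G) #|nbrs u|.
Proof.
pose D := [set xy : G * G | adj xy.1 xy.2].
pose e (xy : G * G) := [set xy.1; xy.2].
have -> : \sum_(u : G) #|nbrs u| = #|D|.
  rewrite -sum1_card (eq_bigl (fun xy => adj xy.1 xy.2)); last by move=> xy; rewrite inE.
  rewrite -(pair_big_dep xpredT (fun u w => adj u w) (fun _ _ => 1)) /=.
  by apply: eq_bigr => u _; rewrite -sum1_card; apply: eq_bigl => w; rewrite inE.
rewrite -sum1_card (partition_big e (mem (edges G))) /=; last first.
  by move=> [a b] /=; rewrite inE /= => ab; apply/imsetP; exists (a, b); rewrite ?inE.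
rewrite -muln2 -sum_nat_const; apply: leq_sum => E /imsetP[[a b]]; rewrite inE /= => ab ->.
have neq : (a, b) != (b, a).
  by apply: contraTneq ab => -[-> _]; rewrite adj_irrefl.
have c2 : #|[set (a, b); (b, a)]| = 2 by rewrite cards2 neq.
rewrite sum1_card -c2; apply: subset_leq_card.
apply/subsetP=> xy /set2P[] ->; rewrite unfold_in /= !inE /= ?ab ?eqxx //.
by rewrite adj_sym ab /e /= setUC eqxx.
Qed.

Import Order.TTheory GRing.Theory Num.Theory.
Local Open Scope ring_scope.

Theorem theorem2 (T : sgraph) (k p : nat)
    (T_tree : is_tree T)
    (T_edges : nedges T = k)
    (T_preleaves : #|preleaves T| = p)
    (T_big_preleaf : exists2 x : T, x \in preleaves T &
       (k%:R - p%:R - 1) / 2%:R <= #|[set y in leaves T | adj x y]|%:R :> rat)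
    (G : sgraph)
    (G_dense : (k%:R - 1) * (nvertices G)%:R < 2%:R * (nedges G)%:R :> rat) :
  contains G T.
Proof.
have [x0 x0P big] := T_big_preleaf.
(* A preleaf with the most leaves satisfies the same bound, and the arguments for one and two
   bearers rely on its being maximal. *)
have [v vP maxv] := arg_maxnP (P := mem (preleaves T)) (@twig_count T) x0P.
have lev : (k <= (twig_count v).*2 + p + 1)%N.
  have : (k <= (twig_count x0).*2 + p + 1)%N.
    move: big; rewrite -/(twig_count x0) ler_pdivrMr ?ltr0n // !lerBlDr => big.
    by rewrite -(ler_nat rat) !natrD -muln2 natrM; rewrite addrAC.
  by have := maxv x0 x0P; rewrite /= -!addnn; lia.
apply: (dense_contains (k := k)) => [H denseH x xdeg|].
  apply: (preleaf_core_case T_tree vP T_edges _ _ denseH xdeg); first by rewrite T_preleaves.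
  by move=> u /maxv.
have := double_nedges G; rewrite -muln2.
have : (k * #|G| < nedges G * 2 + #|G|)%N.
  rewrite -(ltr_nat rat) natrD !natrM -ltrBlDr mulrC [X in _ < X]mulrC.
  by move: G_dense; rewrite mulrBl mul1r [X in X - _]mulrC.
by lia.
Qed.
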